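(* Let $0\le p<1$ and $q=1-p$. For all $n\ge 1$, \begin{align*} 1-2nq^{n-1}&\le p_n\le\frac{1}{nq^n},\\ 1-\frac{1}{nq^n}&\le pi_n\le nq^{n-1},\\ nq^np_n&\le pi_{n+1}. \end{align*} Moreover, if $p=p(n)$ is such that $nq^n\ge C$ for some fixed $C>0$ as $n\to\infty$, then $nq^n$ can be replaced by $\mathsf{E}(\nu_n-1)(1+o(1))$ in these relations; that is, there is a real sequence $\delta_n\to 0$ such that, with $e_n=\mathsf{E}(\nu_n-1)(1+\delta_n)$, for all sufficiently large $n$, $$ 1-\frac{2e_n}{q}\le p_n\le\frac1{e_n},\qquad 1-\frac1{e_n}\le pi_n\le \frac{e_n}{q},\qquad e_np_n\le pi_{n+1}, $$ where $p_n$, $pi_n$, $pi_{n+1}$, $\nu_n$ are all taken with the edge probability $p=p(n)$.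
   Context: $G(n,p)$ is the random graph on $n$ labeled vertices in which each of the $\binom n2$ possible edges is present with probability $p$, independently of the others. $\nu_n$ is the number of connected components of $G(n,p)$. $p_n$ is the probability that $G(n,p)$ is connected. $pi_n$ (a single symbol) is the probability that $G(n,p)$ has at least one isolated vertex, and $pi_{n+1}$ is the same probability for $G(n+1,p)$ with the same $p$. $\mathsf{E}$ denotes expectation. *)

(* Defs.v *)
From HB Require Import structures.
From mathcomp Require Import all_boot all_order all_algebra.
From mathcomp Require Import all_classical all_reals all_analysis.

Set Implicit Arguments.
Unset Strict Implicit.
Unset Printing Implicit Defensive.

Import Order.TTheory GRing.Theory Num.Theory.
Import numFieldNormedType.Exports.
Local Open Scope ring_scope.

(* A simple graph on the vertex set 'I_n is identified with its set of edges,
   a subset of [possible_edges n]; edges are two-element vertex sets. *)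
Definition possible_edges (n : nat) : {set {set 'I_n}} :=
  [set e : {set 'I_n} | #|e| == 2].

Definition graphs (n : nat) : {set {set {set 'I_n}}} :=
  powerset (possible_edges n).

(* For G in [graphs n] this is irreflexive, since [set u; u] has one element. *)
Definition adj (n : nat) (G : {set {set 'I_n}}) : rel 'I_n :=
  fun u v => [set u; v]%SET \in G.

Lemma adj_sym (n : nat) (G : {set {set 'I_n}}) : symmetric (adj G).
Proof. by move=> u v; rewrite /adj finset.setUC. Qed.

(* [n_comp] counts connected components because [adj G] is symmetric. *)
Definition ncomponents (n : nat) (G : {set {set 'I_n}}) : nat :=
  n_comp (adj G) 'I_n.

Definition is_connected (n : nat) (G : {set {set 'I_n}}) : bool :=
  [forall u, forall v, connect (adj G) u v].

Definition has_isolated (n : nat) (G : {set {set 'I_n}}) : bool :=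
  [exists v, forall u, ~~ adj G v u].

(* The law of G(n,p): the product over all possible edges of independent
   Bernoulli(p) laws. *)
Definition gnp (R : realType) (n : nat) (p : R) (G : {set {set 'I_n}}) : R :=
  \prod_(e in possible_edges n) (if e \in G then p else 1 - p).

Definition gnp_pr (R : realType) (n : nat) (p : R)
    (A : pred {set {set 'I_n}}) : R :=
  \sum_(G in graphs n | A G) gnp p G.

Definition gnp_expect (R : realType) (n : nat) (p : R)
    (X : {set {set 'I_n}} -> R) : R :=
  \sum_(G in graphs n) gnp p G * X G.

(* The probability that all edges of S are present is p ^ #|S|: every edge has
   probability p, distinct edges are independent, and (S = set0) the total
   mass is 1. *)
Lemma gnp_edges_present (R : realType) (n : nat) (p : R)
    (S : {set {set 'I_n}}) :
  S \subset possible_edges n ->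
  gnp_pr p (fun G => S \subset G) = p ^+ #|S|.
Proof.
move=> /fintype.subsetP SE; pose E := possible_edges n.
pose F e (b : bool) : R :=
  if e \in E then (if b then p else (e \notin S)%:R * (1 - p)) else (~~ b)%:R.
transitivity (\sum_(G in {set {set 'I_n}}) \prod_e F e (e \in G)).
  rewrite /gnp_pr big_mkcond; apply: eq_bigr => G _.
  rewrite powersetE; case: (boolP (G \subset E)) => [/fintype.subsetP GE|] /=.
    have -> : \prod_e F e (e \in G) = \prod_(e in E) F e (e \in G).
      rewrite (bigID (mem E)) /= [X in _ * X]big1 ?mulr1 // => e eE.
      by rewrite /F (negbTE eE) (contraNF (GE e) eE).
    case: (boolP (S \subset G)) => [/fintype.subsetP SG|].
      apply: eq_bigr => e eE; rewrite /F eE; case: ifPn => // eG.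
      by rewrite (contra (SG e) eG) mul1r.
    case/subsetPn => e eS eG; rewrite (bigD1 e) ?SE //=.
    by rewrite /F SE // (negbTE eG) eS !mul0r.
  case/subsetPn => e eG eE; rewrite (bigD1 e) //=.
  by rewrite /F (negbTE eE) eG mul0r.
transitivity (\prod_e (F e true + F e false)).
  rewrite bigA_distr; apply: eq_bigr => G _.
  by apply: eq_bigr => e _; case: ifP.
rewrite (bigID (mem S)) /= [X in _ * X]big1 ?mulr1; last first.
  move=> e eS; rewrite /F eS; case: ifP => _; last by rewrite add0r.
  by rewrite mul1r addrC subrK.
rewrite (eq_bigr (fun=> p)) ?prodr_const // => e eS.
by rewrite /F SE // eS mul0r addr0.
Qed.

Definition pr_connected (R : realType) (n : nat) (p : R) : R :=
  gnp_pr p (@is_connected n).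

Definition pr_isolated (R : realType) (n : nat) (p : R) : R :=
  gnp_pr p (@has_isolated n).

(* E(nu_n - 1), nu_n being the number of connected components of G(n,p). *)
Definition mean_extra_components (R : realType) (n : nat) (p : R) : R :=
  gnp_expect p (fun G : {set {set 'I_n}} => (ncomponents G)%:R - 1).

(* Main.v *)
Require Import Defs.
From mathcomp Require Import all_boot all_order all_algebra.
From mathcomp Require Import reals zify ring lra.

Set Implicit Arguments.
Unset Strict Implicit.
Unset Printing Implicit Defensive.

Import Order.TTheory GRing.Theory Num.Theory.
Local Open Scope ring_scope.

(** Write q = 1 - p, and let p_n, pi_n, nu_n be the probability of
    connectedness, the probability of an isolated vertex and the number of
    components.

    Everything rests on the independence of disjoint sets of edges
    ([bern_pr_split]). A given set of k vertices is a component with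
    probability p_k q^(k(n-k)) ([pr_mem_comps]), so that b_k(n) =
    'C(n,k) p_k q^(k(n-k)) is the mean number of components of size k. A given
    set of k vertices is the set of all isolated vertices with a probability
    proportional to 1 - pi_(n-k) ([pr_isolated_set]). The latter events are
    disjoint for different sets, which gives
    'C(n+k,k) q^(nk + k(k-1)/2) (1 - pi_n) <= pi_(n+k) ([pr_no_isolated_le]).
    For k = 1 this is n q^n (1 - pi_n) <= pi_(n+1); with p_n <= 1 - pi_n for
    n >= 2 it yields the third relation, the upper bound for p_n and the lower
    bound for pi_n. The upper bound for pi_n is the union bound.

    The lower bound for p_n uses that the component sizes add up to n, that
    is, the sum of k b_k(m) over k is m for every m ([sum_mean_comps]). Hence
    n (1 - p_n) is the sum of k b_k(n) over k < n. The sizes 1 and n - 1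
    contribute at most n^2 q^(n-1). The other sizes contribute no more than
    that: one passes from n to a smaller number M of vertices, where the
    weighted sum is at most M, and the ratio
    b_k(n) / b_k(M) = 'C(n,k) / 'C(M,k) q^(k(n-M)) is largest at an end of
    each range of k ([bin_pow_quasiconvex], [sum_mean_comps_window]).

    For the last part, E(nu_n - 1) need not be close to n q^n: for p = c/n it
    is a different multiple of n. Instead, with mu = E(nu_n - 1), the five
    relations hold for any e that is at least mu or at least n q^n and
    satisfies e (1 - pi_n) <= pi_(n+1) ([relations_of_threshold]). Since n q^n
    is at most pi_(n+1) / (1 - pi_n), the smaller of mu and that quotient is
    such an e, and it remains to see that it is (1 + o(1)) mu, in other words
    that mu (1 - pi_n) <= (1 + o(1)) pi_(n+1). There are two regimes. If q^n
    is small, then apart from isolated vertices the components of size at most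
    n / 2 are negligible, and mu <= n q^n (1/q + o(1))
    ([mean_extra_le_sparse]); the hypothesis n q^n >= C makes p tend to 0
    ([edge_pr_small]). If q^n is not small, then 1 - pi_n is of order 1/n^2 at
    most while mu <= n, and pi_(n+1) >= 1/2 ([no_isolated_mean_extra_dense]). *)

Ltac nat_lia :=
  repeat match goal with
  | H : is_true (Order.le _ _) |- _ => clear H
  | H : is_true (Order.lt _ _) |- _ => clear H
  | H : forall _, _ |- _ => clear H
  end; lia.

(** * Independent Bernoulli subsets of a finite set *)

Definition bern_weight (R : realType) (T : finType) (E : {set T}) (p : R)
    (G : {set T}) : R :=
  \prod_(e in E) (if e \in G then p else 1 - p).

Definition bern_pr (R : realType) (T : finType) (E : {set T}) (p : R)
    (A : pred {set T}) : R :=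
  \sum_(G in powerset E | A G) bern_weight E p G.

Lemma bern_weight_ge0 (R : realType) (T : finType) (E : {set T}) (p : R) G :
  0 <= p <= 1 -> 0 <= bern_weight E p G.
Proof.
case/andP=> p0 p1; apply: prodr_ge0 => e _.
by case: ifP; rewrite ?subr_ge0.
Qed.

Lemma bern_pr_ge0 (R : realType) (T : finType) (E : {set T}) (p : R)
    (A : pred {set T}) :
  0 <= p <= 1 -> 0 <= bern_pr E p A.
Proof. by move=> p01; apply: sumr_ge0 => G _; exact: bern_weight_ge0. Qed.

Lemma bern_pr_total (R : realType) (T : finType) (E : {set T}) (p : R) :
  bern_pr E p predT = 1.
Proof.
pose F e (b : bool) : R :=
  if e \in E then (if b then p else 1 - p) else (~~ b)%:R.
transitivity (\sum_(G in {set T}) \prod_e F e (e \in G)).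
  rewrite /bern_pr big_mkcond; apply: eq_bigr => G _; rewrite powersetE andbT.
  case: ifPn => [/subsetP GE | /subsetPn[e eG eE]].
    rewrite (bigID (mem E)) /= [X in _ = _ * X]big1 ?mulr1 => [|e eE].
      by apply: eq_bigr => e eE; rewrite /F eE.
    by rewrite /F (negbTE eE) (contraNF (GE e) eE).
  by rewrite (bigD1 e) //= /F (negbTE eE) eG mul0r.
transitivity (\prod_e (F e true + F e false)).
  rewrite bigA_distr; apply: eq_bigr => G _.
  by apply: eq_bigr => e _; case: ifP.
rewrite big1 // => e _; rewrite /F; case: ifP => _; last by rewrite add0r.
by rewrite addrC subrK.
Qed.

Lemma bern_pr_ext (R : realType) (T : finType) (E : {set T}) (p : R)
    (A B : pred {set T}) :
  (forall G : {set T}, G \subset E -> A G = B G) -> bern_pr E p A = bern_pr E p B.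
Proof.
move=> AB; apply: eq_bigl => G; rewrite powersetE.
by case: (boolP (G \subset E)) => //= /AB.
Qed.

Lemma bern_pr_le (R : realType) (T : finType) (E : {set T}) (p : R)
    (A B : pred {set T}) :
  0 <= p <= 1 -> (forall G : {set T}, G \subset E -> A G -> B G) ->
  bern_pr E p A <= bern_pr E p B.
Proof.
move=> p01 AB; rewrite /bern_pr big_mkcond [leRHS]big_mkcond.
apply: ler_sum => G _; rewrite powersetE.
case: (boolP (G \subset E)) => //= GE.
case: ifP => [/(AB _ GE)-> // | _]; case: ifP => // _.
exact: bern_weight_ge0.
Qed.

Lemma bern_pr_le1 (R : realType) (T : finType) (E : {set T}) (p : R)
    (A : pred {set T}) :
  0 <= p <= 1 -> bern_pr E p A <= 1.
Proof. by move=> p01; rewrite -(bern_pr_total E p); apply: bern_pr_le. Qed.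

Lemma bern_prC (R : realType) (T : finType) (E : {set T}) (p : R)
    (A : pred {set T}) :
  bern_pr E p (fun G => ~~ A G) = 1 - bern_pr E p A.
Proof.
rewrite -(bern_pr_total E p) /bern_pr.
rewrite [X in _ = X - _](bigID A) /= addrAC.
under [X in X - _]eq_bigl do rewrite andbT.
rewrite subrr add0r; apply: eq_bigl => G; by rewrite andbT.
Qed.

(** This is independence: a subset of the union of two disjoint blocks is a
    pair of subsets, and its weight is the product of their weights. *)
Lemma bern_pr_split (R : realType) (T : finType) (E F : {set T}) (p : R)
    (A B : pred {set T}) :
  [disjoint E & F] ->
  bern_pr (E :|: F) p (fun G => A (G :&: E) && B (G :&: F)) =
  bern_pr E p A * bern_pr F p B.
Proof.
move=> dEF; rewrite /bern_pr big_distrlr /= pair_big /=.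
have IF (X Y : {set T}) : X \subset E -> Y \subset F ->
    (X :|: Y) :&: E = X /\ (X :|: Y) :&: F = Y.
  move=> /subsetP XE /subsetP YF; split; apply/setP => e; rewrite !inE.
    case: (boolP (e \in X)) => [/XE-> // | _] /=.
    by apply/negP => /andP[/YF eF eE]; rewrite (disjointFr dEF eE) in eF.
  case: (boolP (e \in Y)) => [/YF-> // | _] /=; first by rewrite orbT.
  rewrite orbF; apply/negP => /andP[/XE eE eF].
  by rewrite (disjointFr dEF eE) in eF.
rewrite (reindex_onto (fun XY : {set T} * {set T} => XY.1 :|: XY.2)
                      (fun G => (G :&: E, G :&: F))) /=; last first.
  move=> G; rewrite powersetE => /andP[/setIidPl GE _].
  by rewrite -setIUr.
apply: eq_big => [[X Y] /= | [X Y] /=].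
  rewrite !powersetE; apply/idP/idP.
    case/andP=> /and3P[XYs AX BY] /eqP[eX eY]; rewrite eX eY in AX BY.
    have XE : X \subset E by rewrite -eX subsetIr.
    have YF : Y \subset F by rewrite -eY subsetIr.
    by rewrite AX BY XE YF.
  case/andP=> /andP[XE AX] /andP[YF BY].
  by have [-> ->] := IF _ _ XE YF; rewrite AX BY setUSS //= eqxx.
rewrite !powersetE => /andP[_ /eqP[eX eY]].
have XE : X \subset E by rewrite -eX subsetIr.
have YF : Y \subset F by rewrite -eY subsetIr.
rewrite /bern_weight (eq_bigl _ _ (fun e => in_setU e E F)) bigU //=.
congr (_ * _); apply: eq_bigr => e eE.
  by rewrite -[in RHS]eX !inE eE andbT.
by rewrite -[in RHS]eY !inE eE andbT.
Qed.

Lemma bern_pr_empty (R : realType) (T : finType) (E : {set T}) (p : R) :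
  bern_pr E p (fun G => G == set0) = (1 - p) ^+ #|E|.
Proof.
rewrite /bern_pr (big_pred1 set0) => [|G]; last first.
  by rewrite powersetE /=; case: eqP => [->|]; rewrite ?sub0set ?andbF.
by rewrite -prodr_const; apply: eq_bigr => e _; rewrite inE.
Qed.

(** The form in which independence is applied: conditioning on the absence of
    a block F just removes F from the ground set. *)
Lemma bern_pr_absent (R : realType) (T : finType) (E F : {set T}) (p : R)
    (A : pred {set T}) :
  F \subset E ->
  bern_pr E p (fun G => (G :&: F == set0) && A (G :\: F)) =
  (1 - p) ^+ #|F| * bern_pr (E :\: F) p A.
Proof.
move=> FE; rewrite -(bern_pr_empty F) -bern_pr_split; last first.
  by rewrite disjoint_sym disjoints_subset subsetDr.
have -> : F :|: (E :\: F) = E by rewrite -{1}(setIidPr FE) setID.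
apply: bern_pr_ext => G /setIidPl GE.
by rewrite -[X in A (X :\: F)]GE setIDA.
Qed.

Lemma bern_pr_imset (R : realType) (T T' : finType) (f : T -> T')
    (E : {set T}) (p : R) (A : pred {set T'}) :
  injective f ->
  bern_pr (f @: E) p A = bern_pr E p (fun G => A (f @: G)).
Proof.
move=> injf; rewrite /bern_pr.
rewrite (reindex_onto (fun G : {set T} => f @: G) (fun G => f @^-1: G)) /=.
  have preK (G : {set T}) : f @^-1: (f @: G) = G.
    by apply/setP => x; rewrite !inE mem_imset.
  apply: eq_big => [G | G _].
    rewrite !powersetE preK eqxx andbT; congr (_ && _).
    apply/subsetP/subsetP => GE x => [xG | /imsetP[y yG ->]].
      by rewrite -(mem_imset _ _ injf) GE // imset_f.
    by rewrite imset_f // GE.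
  rewrite /bern_weight big_imset => [|x y _ _ /injf //].
  by apply: eq_bigr => e _; rewrite mem_imset.
move=> G; rewrite powersetE => /andP[GE _]; apply/setP => y.
apply/imsetP/idP => [[x] | yG]; first by rewrite inE => xG ->.
have /imsetP[x _ yx] := subsetP GE _ yG.
by exists x => //; rewrite inE -yx.
Qed.

(** * Components and isolated vertices of a labelled graph *)

Definition edges_in (n : nat) (U : {set 'I_n}) : {set {set 'I_n}} :=
  [set e : {set 'I_n} | e \subset U & #|e| == 2].

Definition cross_edges (n : nat) (S : {set 'I_n}) : {set {set 'I_n}} :=
  edges_in [set: 'I_n] :\: (edges_in S :|: edges_in (~: S)).

Definition touching_edges (n : nat) (S : {set 'I_n}) : {set {set 'I_n}} :=
  edges_in [set: 'I_n] :\: edges_in (~: S).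

Definition component (n : nat) (G : {set {set 'I_n}}) (v : 'I_n) : {set 'I_n} :=
  [set u | connect (adj G) v u].

Definition comps (n : nat) (G : {set {set 'I_n}}) : {set {set 'I_n}} :=
  [set component G v | v : 'I_n].

Definition connected_on (n : nat) (U : {set 'I_n}) (G : {set {set 'I_n}}) :=
  [forall u in U, forall v in U, connect (adj G) u v].

Definition isolated_set (n : nat) (G : {set {set 'I_n}}) : {set 'I_n} :=
  [set v | [forall u, ~~ adj G v u]].

Definition no_isolated_on (n : nat) (U : {set 'I_n}) (G : {set {set 'I_n}}) :=
  [forall v in U, exists u, adj G v u].

Lemma possible_edgesE (n : nat) : possible_edges n = edges_in [set: 'I_n].
Proof. by apply/setP => e; rewrite !inE subsetT. Qed.

Lemma gnp_pr_bern (R : realType) (n : nat) (p : R)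
    (A : pred {set {set 'I_n}}) :
  gnp_pr p A = bern_pr (edges_in [set: 'I_n]) p A.
Proof. by rewrite -possible_edgesE. Qed.

Lemma card_edges_in (n : nat) (U : {set 'I_n}) : #|edges_in U| = 'C(#|U|, 2).
Proof. by rewrite -cards_draws. Qed.

Lemma edges_inS (n : nat) (U V : {set 'I_n}) :
  U \subset V -> edges_in U \subset edges_in V.
Proof.
move=> UV; apply/subsetP => e; rewrite !inE => /andP[eU ->].
by rewrite (subset_trans eU UV).
Qed.

Lemma edges_in_disjoint (n : nat) (S : {set 'I_n}) :
  [disjoint edges_in S & edges_in (~: S)].
Proof.
rewrite -setI_eq0; apply/eqP/setP => e; rewrite !inE.
apply/negP => /andP[/andP[eS /eqP e2] /andP[eC _]].
have : e \subset S :&: ~: S by rewrite subsetI eS.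
by rewrite setICr subset0 => /eqP e0; rewrite e0 cards0 in e2.
Qed.

Lemma bin2_add (a b : nat) : 'C(a + b, 2) = ('C(a, 2) + 'C(b, 2) + a * b)%N.
Proof.
elim: a => [|a IH]; first by rewrite !add0n addn0.
rewrite addSn !binS !bin1 IH mulSn; lia.
Qed.

Lemma card_cross_edges (n : nat) (S : {set 'I_n}) :
  #|cross_edges S| = (#|S| * (n - #|S|))%N.
Proof.
have nE : (#|S| + #|~: S| = n)%N by rewrite cardsC card_ord.
rewrite cardsD (setIidPr _); last by rewrite subUset !edges_inS ?subsetT.
have /eqP d0 : edges_in S :&: edges_in (~: S) == set0.
  by rewrite setI_eq0 edges_in_disjoint.
rewrite cardsU d0 cards0 subn0 !card_edges_in cardsT card_ord -{1}nE bin2_add.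
have -> : (n - #|S| = #|~: S|)%N by rewrite -{1}nE addKn.
by rewrite addKn.
Qed.

Lemma card_touching_edges (n : nat) (S : {set 'I_n}) :
  #|touching_edges S| = ('C(n, 2) - 'C(n - #|S|, 2))%N.
Proof.
rewrite cardsD (setIidPr _) ?edges_inS ?subsetT //.
by rewrite !card_edges_in cardsT card_ord cardsCs setCK card_ord.
Qed.

Lemma adj_setI (n : nat) (U : {set 'I_n}) (G : {set {set 'I_n}}) u v :
  G \subset edges_in [set: 'I_n] ->
  adj (G :&: edges_in U) u v = [&& adj G u v, u \in U & v \in U].
Proof.
move=> /subsetP GE; rewrite /adj in_setI; case: (boolP (_ \in G)) => //= uvG.
have := GE _ uvG; rewrite !inE subsetT /= => ->.
by rewrite andbT subUset !sub1set.
Qed.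

Lemma mem_cross_edges (n : nat) (S : {set 'I_n}) u v :
  u \in S -> v \notin S -> [set u; v] \in cross_edges S.
Proof.
move=> uS vS; rewrite !inE !subUset !sub1set !inE uS (negbTE vS) andbF /=.
have uv : u != v by apply: contraNneq vS => <-.
by rewrite cards2 uv.
Qed.

Lemma mem_component (n : nat) (G : {set {set 'I_n}}) v : v \in component G v.
Proof. by rewrite inE. Qed.

Lemma component_eq (n : nat) (G : {set {set 'I_n}}) u v :
  (component G u == component G v) = (u \in component G v).
Proof.
have csym := sym_connect_sym (adj_sym G).
apply/eqP/idP => [<- | ]; first exact: mem_component.
rewrite inE => vu; apply/setP => w; rewrite !inE.
by rewrite (same_connect csym vu).
Qed.

(** A path that starts in a component never leaves it, so it only uses edges
    inside that component. *)
Lemma connected_on_comp (n : nat) (G : {set {set 'I_n}}) v :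
  G \subset edges_in [set: 'I_n] ->
  connected_on (component G v) (G :&: edges_in (component G v)).
Proof.
move=> GE; set H := _ :&: _.
have Hsym := sym_connect_sym (adj_sym H).
suff vH u : u \in component G v -> connect (adj H) v u.
  apply/forall_inP => u uC; apply/forall_inP => w wC.
  by apply: (connect_trans (y := v)); [rewrite Hsym; apply: vH | apply: vH].
rewrite inE => vu.
have cl : closed (adj G) (connect (adj H) v).
  apply: intro_closed; first exact: sym_connect_sym (adj_sym G).
  move=> x y xy vx; apply: (connect_trans vx); apply: connect1.
  have vxG : connect (adj G) v x.
    apply: connect_sub vx => a b; rewrite adj_setI // => /andP[ab _].
    exact: connect1.
  rewrite adj_setI // xy !inE vxG; apply: (connect_trans vxG).
  exact: connect1.
by have := closed_connect cl vu; rewrite !inE connect0 => <-.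
Qed.

(** The two conditions on G on the right concern disjoint sets of edges, the
    ones leaving S and the ones inside S, so that they are independent. *)
Lemma compsE (n : nat) (G : {set {set 'I_n}}) (S : {set 'I_n}) :
  G \subset edges_in [set: 'I_n] ->
  (S \in comps G) =
  [&& S != set0, G :&: cross_edges S == set0 &
      connected_on S (G :&: edges_in S)].
Proof.
move=> GE; have csym := sym_connect_sym (adj_sym G).
apply/imsetP/and3P => [[v _ ->] | [/set0Pn[v vS] cS oS]].
  split; [by apply/set0Pn; exists v; exact: mem_component | | ]; last first.
    exact: connected_on_comp.
  apply/negPn/negP => /set0Pn[e]; rewrite inE => /andP[eG].
  have := subsetP GE _ eG; rewrite !inE => /andP[_ e2]; rewrite subsetT e2 /=.
  rewrite !andbT negb_or => /andP[/subsetPn[a ae aC]].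
  case/subsetPn => b be; rewrite !inE negbK => vb; rewrite inE in aC.
  have ba : b != a by apply: contraNneq aC => <-.
  have e_ba : e = [set b; a].
    apply/eqP; rewrite eq_sym eqEcard subUset !sub1set ae be /=.
    by rewrite (eqP e2) cards2 ba.
  case/negP: aC; apply: (connect_trans vb); apply: connect1.
  by rewrite /adj -e_ba.
exists v => //; apply/setP => u; rewrite inE.
have cl : closed (adj G) S.
  apply: intro_closed => // x y xy xS; apply/negPn/negP => yS.
  have : [set x; y] \in G :&: cross_edges S.
    by rewrite inE (mem_cross_edges xS yS) andbT.
  by rewrite (eqP cS) inE.
apply/idP/idP => [uS | /(closed_connect cl) <- //].
have /forall_inP/(_ v vS)/forall_inP/(_ u uS) := oS.
apply: connect_sub => a b; rewrite adj_setI // => /andP[ab _].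
exact: connect1.
Qed.

(** Again the two conditions concern disjoint sets of edges: those meeting S and
    those avoiding it. The neighbour that a vertex outside S must have lies
    outside S too, because the vertices of S have no neighbours. *)
Lemma isolated_setE (n : nat) (G : {set {set 'I_n}}) (S : {set 'I_n}) :
  G \subset edges_in [set: 'I_n] ->
  (isolated_set G == S) =
  (G :&: touching_edges S == set0) &&
  no_isolated_on (~: S) (G :\: touching_edges S).
Proof.
move=> GE.
have GD : G :\: touching_edges S = G :&: edges_in (~: S).
  apply/setP => e; rewrite /touching_edges in_setD !in_setI in_setD.
  by case: (boolP (e \in G)) => [/(subsetP GE)->|]; 
    rewrite ?andbF //= negb_and negbK orbF andbT.
rewrite GD; apply/eqP/andP => [<- | [tS nS]].
  split.
    apply/negPn/negP => /set0Pn[e]; rewrite inE => /andP[eG].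
    rewrite in_setD => /andP[eC]; rewrite inE => /andP[_ /cards2P[a [b [ab e_ab]]]].
    move: eC eG; rewrite inE e_ab cards2 ab andbT subUset !sub1set negb_and.
    rewrite !inE !negbK => /orP[] /forallP; [move/(_ b) | move/(_ a)].
      by move=> /negP nab eG; case: nab.
    by rewrite adj_sym => /negP nab eG; case: nab.
  apply/forall_inP => v; rewrite !inE negb_forall => /existsP[u].
  rewrite negbK => vu; apply/existsP; exists u; rewrite adj_setI // vu !inE /=.
  apply/andP; split; rewrite negb_forall; apply/existsP.
    by exists u; rewrite negbK.
  by exists v; rewrite negbK adj_sym.
apply/setP => v; rewrite inE; apply/forallP/idP => [iv | vS u].
  apply: contraT => vS.
  have /forall_inP/(_ v) := nS; rewrite inE => /(_ vS) /existsP[u].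
  by rewrite adj_setI // (negbTE (iv u)).
apply/negP => vu; have : [set v; u] \in G :&: touching_edges S.
  rewrite in_setI [_ \in G]vu in_setD (subsetP GE) // andbT.
  by rewrite inE subUset !sub1set !inE vS.
by rewrite (eqP tS) inE.
Qed.

(** * Relabelling the vertices *)

Lemma set_ord_param (n k : nat) (U : {set 'I_n}) :
  #|U| = k -> exists2 f : 'I_k -> 'I_n, injective f & f @: setT = U.
Proof.
move=> <-; exists enum_val; first exact: enum_val_inj.
apply/setP => x; apply/imsetP/idP => [[i _ ->] | xU]; first exact: enum_valP.
by exists (enum_rank_in xU x); rewrite // enum_rankK_in.
Qed.

Definition relabel (n k : nat) (f : 'I_k -> 'I_n) (G : {set {set 'I_k}}) :
    {set {set 'I_n}} :=
  [set f @: (e : {set 'I_k}) | e in G].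

Lemma edges_in_relabel (n k : nat) (f : 'I_k -> 'I_n) :
  injective f -> edges_in (f @: setT) = relabel f (edges_in setT).
Proof.
move=> injf; apply/setP => e; rewrite inE; apply/andP/imsetP.
  case=> /subsetP eU e2; have fe : e = f @: (f @^-1: e).
    apply/setP => v; apply/idP/imsetP => [ve | [i]]; last first.
      by rewrite inE => fi ->.
    by have /imsetP[i _ vi] := eU _ ve; exists i; rewrite // inE -vi.
  by exists (f @^-1: e) => //; rewrite inE subsetT -(card_imset _ injf) -fe.
by case=> e'; rewrite inE => /andP[_ e2] ->; rewrite imsetS ?subsetT ?card_imset.
Qed.

Lemma adj_relabel (n k : nat) (f : 'I_k -> 'I_n) (G : {set {set 'I_k}}) i j :
  injective f -> adj (relabel f G) (f i) (f j) = adj G i j.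
Proof.
move=> injf; rewrite /adj /relabel -(mem_imset _ _ (imset_inj injf)).
by rewrite imsetU1 imset_set1.
Qed.

Lemma adj_relabel_im (n k : nat) (f : 'I_k -> 'I_n) (G : {set {set 'I_k}}) i v :
  adj (relabel f G) (f i) v -> exists j, v = f j.
Proof.
move=> /imsetP[e _ /setP/(_ v)]; rewrite !inE eqxx orbT => /esym/imsetP[j _ ->].
by exists j.
Qed.

(** The image of a component is closed under adjacency in the relabelled graph,
    hence no new connection appears. *)
Lemma connected_on_relabel (n k : nat) (f : 'I_k -> 'I_n)
    (G : {set {set 'I_k}}) :
  injective f ->
  connected_on (f @: setT) (relabel f G) = is_connected G.
Proof.
move=> injf; have csym := sym_connect_sym (adj_sym (relabel f G)).
have conn i j : connect (adj (relabel f G)) (f i) (f j) = connect (adj G) i j.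
  apply/idP/idP; last first.
    move=> /connectP[s]; elim: s i => [|i' s IH] i /=; first by move=> _ ->.
    case/andP=> ii' s_path jE; apply: (connect_trans (y := f i')).
      by apply: connect1; rewrite adj_relabel.
    exact: IH.
  have cl : closed (adj (relabel f G)) (f @: [set i' | connect (adj G) i i']).
    apply: intro_closed => // x y xy /imsetP[a ia xa]; move: xy; rewrite xa => ay.
    have [b yb] := adj_relabel_im ay; rewrite yb imset_f // inE.
    rewrite yb adj_relabel // in ay; rewrite inE in ia.
    exact: connect_trans ia (connect1 ay).
  move/(closed_connect cl); rewrite !mem_imset // !inE connect0.
  by move/esym.
apply/forall_inP/forallP => [cn i | cn _ /imsetP[i _ ->]].
  apply/forallP => j; rewrite -conn.
  by have /forall_inP := cn _ (imset_f f (in_setT i)); apply; rewrite imset_f.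
by apply/forall_inP => _ /imsetP[j _ ->]; rewrite conn; apply/forallP: j.
Qed.

Lemma no_isolated_on_relabel (n k : nat) (f : 'I_k -> 'I_n)
    (G : {set {set 'I_k}}) :
  injective f ->
  no_isolated_on (f @: setT) (relabel f G) = ~~ has_isolated G.
Proof.
move=> injf; rewrite negb_exists; apply/forall_inP/forallP => [nI i | nI].
  have /existsP[u iu] := nI _ (imset_f f (in_setT i)).
  rewrite negb_forall; apply/existsP.
  have [j uj] := adj_relabel_im iu.
  by exists j; rewrite negbK -(adj_relabel _ _ _ injf) -uj.
move=> _ /imsetP[i _ ->]; have := nI i; rewrite negb_forall => /existsP[j].
by rewrite negbK => ij; apply/existsP; exists (f j); rewrite adj_relabel.
Qed.

Lemma pr_connected_on (R : realType) (n : nat) (p : R) (U : {set 'I_n}) :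
  bern_pr (edges_in U) p (connected_on U) = pr_connected #|U| p.
Proof.
have [f injf fU] := set_ord_param (erefl #|U|).
rewrite -{1 2}fU edges_in_relabel // bern_pr_imset; last exact: imset_inj.
rewrite /pr_connected gnp_pr_bern; apply: bern_pr_ext => G _.
exact: connected_on_relabel.
Qed.

Lemma pr_no_isolated_on (R : realType) (n : nat) (p : R) (U : {set 'I_n}) :
  bern_pr (edges_in U) p (no_isolated_on U) = 1 - pr_isolated #|U| p.
Proof.
have [f injf fU] := set_ord_param (erefl #|U|).
rewrite -{1 2}fU edges_in_relabel // bern_pr_imset; last exact: imset_inj.
rewrite /pr_isolated gnp_pr_bern -bern_prC; apply: bern_pr_ext => G _.
exact: no_isolated_on_relabel.
Qed.

(** * Probabilities of prescribed components and isolated vertices *)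

Lemma pr_mem_comps (R : realType) (n : nat) (p : R) (S : {set 'I_n}) :
  S != set0 ->
  gnp_pr p (fun G => S \in comps G) =
  pr_connected #|S| p * (1 - p) ^+ (#|S| * (n - #|S|)).
Proof.
move=> S0; rewrite gnp_pr_bern -card_cross_edges mulrC -pr_connected_on.
have cE : cross_edges S \subset edges_in [set: 'I_n] by rewrite subsetDl.
have -> : bern_pr (edges_in S) p (connected_on S) =
    bern_pr (edges_in [set: 'I_n] :\: cross_edges S) p
            (fun G => connected_on S (G :&: edges_in S)).
  have -> : edges_in [set: 'I_n] :\: cross_edges S =
            edges_in S :|: edges_in (~: S).
    rewrite setDDr setDv set0U; apply/setIidPr.
    by rewrite subUset !edges_inS ?subsetT.
  rewrite -[LHS]mulr1 -(bern_pr_total (edges_in (~: S)) p).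
  rewrite -bern_pr_split ?edges_in_disjoint //.
  by apply: bern_pr_ext => G _; rewrite andbT.
rewrite -bern_pr_absent //; apply: bern_pr_ext => G GE.
rewrite compsE // S0 /=; congr (_ && connected_on _ _).
apply/setP => e; rewrite !inE; case: (e \in G); rewrite ?andbF //= andbT.
by case: (e \subset S); rewrite ?andbF //=; case: (#|e| == 2); rewrite ?andbF.
Qed.

Lemma pr_isolated_set (R : realType) (n : nat) (p : R) (S : {set 'I_n}) :
  gnp_pr p (fun G => isolated_set G == S) =
  (1 - p) ^+ ('C(n, 2) - 'C(n - #|S|, 2)) * (1 - pr_isolated (n - #|S|) p).
Proof.
rewrite -card_touching_edges.
have -> : (n - #|S| = #|~: S|)%N by rewrite [RHS]cardsCs setCK card_ord.
rewrite gnp_pr_bern -pr_no_isolated_on.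
have -> : edges_in (~: S) = edges_in [set: 'I_n] :\: touching_edges S.
  rewrite setDDr setDv set0U; apply/esym/setIidPr.
  by rewrite edges_inS ?subsetT.
rewrite -bern_pr_absent ?subsetDl //; apply: bern_pr_ext => G GE.
exact: isolated_setE.
Qed.

(** Here only the absence of the n - 1 edges at v matters. *)
Lemma pr_mem_isolated_set (R : realType) (n : nat) (p : R) (v : 'I_n) :
  gnp_pr p (fun G => v \in isolated_set G) = (1 - p) ^+ n.-1.
Proof.
have n_gt0 : (0 < n)%N by case: n v => [[]|].
have -> : n.-1 = #|touching_edges [set v]|.
  rewrite card_touching_edges cards1 subn1.
  by case: n n_gt0 {v} => //= n _; rewrite binS bin1 addKn.
rewrite gnp_pr_bern -[RHS]mulr1.
rewrite -[X in _ * X](bern_pr_total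
  (edges_in [set: 'I_n] :\: touching_edges [set v]) p).
rewrite -bern_pr_absent ?subsetDl //; apply: bern_pr_ext => G GE.
rewrite andbT inE; apply/forallP/idP => [iv | /eqP tv u].
  apply/negPn/negP => /set0Pn[e]; rewrite in_setI => /andP[eG].
  rewrite in_setD => /andP[eC]; rewrite inE => /andP[_ /cards2P[a [b [ab e_ab]]]].
  move: eC eG; rewrite inE e_ab cards2 ab andbT subUset !sub1set negb_and.
  rewrite !inE !negbK => /orP[] /eqP ->.
    by apply/negP; apply: iv.
  by rewrite setUC; apply/negP; apply: iv.
apply/negP => vu; have : [set v; u] \in G :&: touching_edges [set v].
  rewrite in_setI [_ \in G]vu in_setD (subsetP GE) // andbT.
  by rewrite inE subUset !sub1set !inE eqxx.
by rewrite tv inE.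
Qed.

(** * Counting components *)

Lemma gnp_expect_sum (R : realType) (n : nat) (p : R) (I : finType)
    (P : pred I) (c : I -> R) (A : I -> pred {set {set 'I_n}}) :
  gnp_expect p (fun G => \sum_(i | P i) c i * (A i G)%:R) =
  \sum_(i | P i) c i * gnp_pr p (A i).
Proof.
rewrite /gnp_expect; under eq_bigr do rewrite big_distrr /=.
rewrite exchange_big /=; apply: eq_bigr => i _.
rewrite /gnp_pr big_distrr /= [RHS]big_mkcondr /=; apply: eq_bigr => G _.
by case: (A i G); rewrite ?mulr1 ?mulr0 // mulrC.
Qed.

Lemma gnp_expect_indicator (R : realType) (n : nat) (p : R)
    (A : pred {set {set 'I_n}}) :
  gnp_expect p (fun G => (A G)%:R) = gnp_pr p A.
Proof.
rewrite /gnp_pr big_mkcondr; apply: eq_bigr => G _.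
by case: (A G); rewrite ?mulr1 ?mulr0.
Qed.

Lemma gnp_weight_ge0 (R : realType) (n : nat) (p : R) (G : {set {set 'I_n}}) :
  0 <= p <= 1 -> 0 <= gnp p G.
Proof. exact: bern_weight_ge0. Qed.

Lemma gnp_expect_le (R : realType) (n : nat) (p : R)
    (X Y : {set {set 'I_n}} -> R) :
  0 <= p <= 1 ->
  (forall G : {set {set 'I_n}}, G \subset possible_edges n -> X G <= Y G) ->
  gnp_expect p X <= gnp_expect p Y.
Proof.
move=> p01 XY; apply: ler_sum => G; rewrite powersetE => GE.
by apply: ler_wpM2l; [exact: gnp_weight_ge0 | exact: XY].
Qed.

Lemma gnp_expect_cst (R : realType) (n : nat) (p c : R) :
  gnp_expect p (fun _ : {set {set 'I_n}} => c) = c.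
Proof.
rewrite /gnp_expect -big_distrl /= -[RHS]mul1r; congr (_ * _).
rewrite -[RHS](bern_pr_total (possible_edges n) p) /bern_pr.
by apply: eq_bigl => G; rewrite andbT.
Qed.

Lemma sum_by_card (R : realType) (n : nat) (Q : pred nat) (F : nat -> R) :
  \sum_(S : {set 'I_n} | Q #|S|) F #|S| =
  \sum_(k < n.+1 | Q k) 'C(n, k)%:R * F k.
Proof.
have cS (S : {set 'I_n}) : (#|S| < n.+1)%N 
  by rewrite ltnS (leq_trans (max_card _)) ?card_ord.
rewrite (partition_big (fun S => Ordinal (cS S)) (fun k : 'I_n.+1 => Q k)) //=.
apply: eq_bigr => k Qk.
rewrite (eq_bigr (fun=> F k)) => [|S /andP[_ /eqP <-] //].
rewrite sumr_const mulr_natl; congr (_ *+ _).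
have -> : 'C(n, k) = 'C(#|'I_n|, k) by rewrite card_ord.
rewrite -card_draws; apply: eq_card => S.
by rewrite !inE unfold_in /= -val_eqE /=; case: eqP => [->|]; rewrite ?Qk ?andbF.
Qed.

Lemma mem_comps_comp (n : nat) (G : {set {set 'I_n}}) S v :
  S \in comps G -> v \in S -> S = component G v.
Proof.
by case/imsetP => w _ -> vw; apply/eqP; rewrite eq_sym component_eq.
Qed.

Lemma set0_notin_comps (n : nat) (G : {set {set 'I_n}}) : set0 \notin comps G.
Proof.
apply/negP => /imsetP[v _ v0].
by have := mem_component G v; rewrite -v0 inE.
Qed.

Lemma sum_card_comps (n : nat) (G : {set {set 'I_n}}) :
  (\sum_(S in comps G) #|S| = n)%N.
Proof.
rewrite -[RHS]card_ord -[RHS]sum1_card.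
rewrite [RHS](partition_big (component G) (mem (comps G))) /=; last first.
  by move=> v _; apply: imset_f.
apply: eq_bigr => S Sc; rewrite -sum1_card; apply: eq_bigl => v.
apply/idP/eqP => [vS | <-]; last exact: mem_component.
by apply/esym/(mem_comps_comp Sc).
Qed.

Lemma ncomponentsE (n : nat) (G : {set {set 'I_n}}) :
  ncomponents G = #|comps G|.
Proof.
have csym := sym_connect_sym (adj_sym G).
have -> : comps G = component G @: [set v | roots (adj G) v].
  apply/setP => S; apply/imsetP/imsetP => [[v _ ->] | [v _ ->]]; last by exists v.
  exists (fingraph.root (adj G) v); first by rewrite inE roots_root.
  by apply/eqP; rewrite eq_sym component_eq inE connect_root.
rewrite card_in_imset => [|u v].
  by rewrite cardsE; apply: eq_card => v; rewrite !inE andbT.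
rewrite !inE => /eqP ru /eqP rv /eqP; rewrite component_eq inE => vu.
by rewrite -ru -rv; apply/esym/(fingraph.rootP csym).
Qed.

(** At most one component contains more than half of the vertices. *)
Lemma ncomponents_le_small (n : nat) (G : {set {set 'I_n}}) :
  (ncomponents G <= #|[set S in comps G | (#|S|.*2 <= n)%N]|.+1)%N.
Proof.
rewrite ncomponentsE -(cardsID [set S : {set 'I_n} | (#|S|.*2 <= n)%N]) -addn1.
rewrite leq_add //.
  by apply: subset_leq_card; apply/subsetP => S; rewrite !inE.
apply/card_le1_eqP => S S'; rewrite !inE -!ltnNge.
move=> /andP[nS Sc] /andP[nS' S'c].
have [/eqP d | /set0Pn[v]] := boolP (S :&: S' == set0).
  have := max_card (mem (S :|: S')); rewrite card_ord cardsU d cards0 subn0.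
  move=> le_n; have : (#|S|.*2 + #|S'|.*2 <= n.*2)%N by rewrite -doubleD leq_double.
  lia.
rewrite inE => /andP[vS vS'].
by rewrite (mem_comps_comp Sc vS) -(mem_comps_comp S'c vS').
Qed.

Lemma ncomponents_gt0 (n : nat) (G : {set {set 'I_n}}) :
  (0 < n)%N -> (0 < ncomponents G)%N.
Proof.
case: n G => // n G _; rewrite ncomponentsE card_gt0.
by apply/set0Pn; exists (component G ord0); apply: imset_f.
Qed.

Lemma ncomponents_gt1 (n : nat) (G : {set {set 'I_n}}) :
  ~~ is_connected G -> (1 < ncomponents G)%N.
Proof.
rewrite negb_forall => /existsP[u]; rewrite negb_forall => /existsP[v] uv.
rewrite ncomponentsE; apply/card_gt1P; exists (component G u), (component G v).
split; [exact: imset_f | exact: imset_f |].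
by rewrite eq_sym component_eq inE.
Qed.

Lemma ncomponents_le (n : nat) (G : {set {set 'I_n}}) : (ncomponents G <= n)%N.
Proof.
by rewrite ncomponentsE (leq_trans (leq_imset_card _ _)) // card_ord.
Qed.

(** The expected number of components with k vertices, by [pr_mem_comps]. *)
Definition mean_comps (R : realType) (n : nat) (p : R) (k : nat) : R :=
  'C(n, k)%:R * (pr_connected k p * (1 - p) ^+ (k * (n - k))).

Lemma pr_connected_01 (R : realType) (n : nat) (p : R) :
  0 <= p <= 1 -> 0 <= pr_connected n p <= 1.
Proof.
by move=> p01; rewrite /pr_connected gnp_pr_bern bern_pr_ge0 ?bern_pr_le1.
Qed.

Lemma pr_isolated_01 (R : realType) (n : nat) (p : R) :
  0 <= p <= 1 -> 0 <= pr_isolated n p <= 1.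
Proof.
by move=> p01; rewrite /pr_isolated gnp_pr_bern bern_pr_ge0 ?bern_pr_le1.
Qed.

Lemma mean_comps_ge0 (R : realType) (n : nat) (p : R) (k : nat) :
  0 <= p <= 1 -> 0 <= mean_comps n p k.
Proof.
move=> p01; have /andP[c0 _] := pr_connected_01 k p01.
have /andP[_ p1] := p01.
by rewrite mulr_ge0 // mulr_ge0 // exprn_ge0 // subr_ge0.
Qed.

(** The component sizes add up to the number of vertices; this is the
    expectation of that identity. *)
Lemma sum_mean_comps (R : realType) (n : nat) (p : R) :
  \sum_(k < n.+1) k%:R * mean_comps n p k = n%:R.
Proof.
pose F k : R := k%:R * (pr_connected k p * (1 - p) ^+ (k * (n - k))).
transitivity (\sum_(k < n.+1 | predT k) 'C(n, k)%:R * F k).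
  by apply: eq_bigr => k _; rewrite mulrCA.
rewrite -(sum_by_card n predT F) -(gnp_expect_cst n p n%:R).
transitivity (\sum_(S : {set 'I_n}) #|S|%:R * gnp_pr p (fun G => S \in comps G)).
  apply: eq_bigr => S _; rewrite /F; have [->|S0] := eqVneq S set0.
    by rewrite cards0 !mul0r.
  by rewrite pr_mem_comps.
rewrite -gnp_expect_sum; apply: eq_bigr => G _; congr (_ * _).
rewrite -[in RHS](sum_card_comps G) natr_sum [RHS]big_mkcond /=.
by apply: eq_bigr => S _; case: (S \in _); rewrite ?mulr1 ?mulr0.
Qed.

(** Discarding one component, the largest one, leaves only components with at
    most n / 2 vertices. *)
Lemma mean_extra_le_small (R : realType) (n : nat) (p : R) :
  0 <= p <= 1 ->
  mean_extra_components n p <=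
  \sum_(k < n.+1 | (0 < k)%N && (k.*2 <= n)%N) mean_comps n p k.
Proof.
move=> p01; pose Q k := (0 < k)%N && (k.*2 <= n)%N.
rewrite -(sum_by_card n Q (fun k => pr_connected k p * (1 - p) ^+ (k * (n - k)))).
rewrite [leRHS](eq_bigr (fun S : {set 'I_n} =>
    1 * gnp_pr p (fun G => S \in comps G))); last first.
  by move=> S /andP[S0 _]; rewrite mul1r pr_mem_comps // -card_gt0.
rewrite -gnp_expect_sum; apply: gnp_expect_le => // G _.
have -> : \sum_(S : {set 'I_n} | (0 < #|S|)%N && (#|S|.*2 <= n)%N)
      1 * (S \in comps G)%:R =
    #|[set S : {set 'I_n} in comps G | (#|S|.*2 <= n)%N]|%:R :> R.
  rewrite -sum1_card natr_sum big_mkcond [RHS]big_mkcond /=.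
  apply: eq_bigr => S _; rewrite inE mul1r card_gt0.
  case: (boolP (S \in comps G)) => [Sc | _]; last by rewrite if_same.
  by rewrite (contraTneq _ Sc) // => ->; exact: set0_notin_comps.
by rewrite lerBlDr natr1 ler_nat ncomponents_le_small.
Qed.

Lemma mean_extra_ge_disconnected (R : realType) (n : nat) (p : R) :
  (0 < n)%N -> 0 <= p <= 1 ->
  1 - pr_connected n p <= mean_extra_components n p.
Proof.
move=> n0 p01; rewrite /pr_connected gnp_pr_bern -bern_prC -gnp_pr_bern.
rewrite -gnp_expect_indicator.
apply: gnp_expect_le => // G _; rewrite lerBrDr natr1 ler_nat.
case: (boolP (is_connected G)) => [_ | /ncomponents_gt1 //] /=.
exact: ncomponents_gt0.
Qed.

Lemma mean_extra_le (R : realType) (n : nat) (p : R) :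
  0 <= p <= 1 -> mean_extra_components n p <= n%:R.
Proof.
move=> p01; rewrite -(gnp_expect_cst n p n%:R); apply: gnp_expect_le => // G _.
by rewrite lerBlDr natr1 ler_nat ltnW // ltnS ncomponents_le.
Qed.

(** * Isolated vertices *)

Lemma has_isolatedE (n : nat) (G : {set {set 'I_n}}) :
  has_isolated G = (isolated_set G != set0).
Proof.
apply/existsP/set0Pn => -[v]; first by exists v; rewrite inE.
by rewrite inE; exists v.
Qed.

(** The events saying that the isolated vertices are exactly those of a given
    set of size k are disjoint, and each of them asks that the remaining n
    vertices span a graph without isolated vertices. *)
Lemma pr_no_isolated_le (R : realType) (n k : nat) (p : R) :
  0 <= p <= 1 -> (0 < k)%N ->
  'C(n + k, k)%:R * (1 - p) ^+ ('C(n + k, 2) - 'C(n, 2)) *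
    (1 - pr_isolated n p) <= pr_isolated (n + k) p.
Proof.
move=> p01 k0; set w := (1 - p) ^+ _.
have -> : 'C(n + k, k)%:R * w * (1 - pr_isolated n p) =
    \sum_(S : {set 'I_(n + k)} | #|S| == k)
       1 * gnp_pr p (fun G => isolated_set G == S).
  rewrite -mulrA [RHS](eq_bigr (fun=> w * (1 - pr_isolated n p))).
    rewrite sumr_const mulr_natl; congr (_ *+ _).
    have -> : 'C(n + k, k) = 'C(#|'I_(n + k)|, k) by rewrite card_ord.
    rewrite -card_draws.
    by apply: eq_card => S; rewrite !inE.
  by move=> S /eqP Sk; rewrite mul1r pr_isolated_set Sk addnK.
rewrite -gnp_expect_sum /pr_isolated -gnp_expect_indicator.
apply: gnp_expect_le => // G _.
have [cI | cI] := eqVneq #|isolated_set G| k.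
  rewrite (bigD1 (isolated_set G)) ?cI //= eqxx big1 => [|S /andP[_ /negbTE]].
    by rewrite addr0 mul1r has_isolatedE -card_gt0 cI k0.
  by rewrite eq_sym => ->; rewrite mulr0.
rewrite big1 ?ler0n // => S /eqP Sk; rewrite mul1r.
by case: eqP => // IS; rewrite IS Sk eqxx in cI.
Qed.

Lemma pr_connected_le_no_isolated (R : realType) (n : nat) (p : R) :
  0 <= p <= 1 -> (1 < n)%N -> pr_connected n p <= 1 - pr_isolated n p.
Proof.
move=> p01 n1; rewrite /pr_connected /pr_isolated !gnp_pr_bern -bern_prC.
apply: bern_pr_le => // G _ /forallP conn; apply/existsP => -[v /forallP iv].
have [u uv] : exists u : 'I_n, u != v.
  have /card_gt1P[a [b [_ _ ab]]] : (1 < #|'I_n|)%N by rewrite card_ord.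
  by have [av|] := eqVneq a v; [exists b; rewrite -av eq_sym | exists a].
have /forallP/(_ u)/connectP[[|w s] /=] := conn v.
  by move=> _ uE; rewrite uE eqxx in uv.
by rewrite (negbTE (iv w)).
Qed.

Lemma pr_isolated_le (R : realType) (n : nat) (p : R) :
  0 <= p <= 1 -> pr_isolated n p <= n%:R * (1 - p) ^+ n.-1.
Proof.
move=> p01.
have -> : n%:R * (1 - p) ^+ n.-1 = \sum_(v : 'I_n)
    1 * gnp_pr p (fun G => v \in isolated_set G).
  under eq_bigr do rewrite mul1r pr_mem_isolated_set.
  by rewrite sumr_const card_ord mulr_natl.
rewrite -gnp_expect_sum /pr_isolated -gnp_expect_indicator.
apply: gnp_expect_le => // G _; rewrite has_isolatedE.
have [_ | /set0Pn[v vI]] := eqVneq; first by apply: sumr_ge0 => v _; rewrite mul1r.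
by rewrite (bigD1 v) //= vI mul1r lerDl sumr_ge0 // => u _; rewrite mul1r.
Qed.

Lemma pr_isolated_ge (R : realType) (n : nat) (p : R) :
  0 <= p <= 1 -> (0 < n)%N -> (1 - p) ^+ n.-1 <= pr_isolated n p.
Proof.
move=> p01; case: n => // n _; rewrite -(pr_mem_isolated_set p (ord0 : 'I_n.+1)).
rewrite /pr_isolated !gnp_pr_bern; apply: bern_pr_le => // G _.
by rewrite inE => v0; apply/existsP; exists ord0.
Qed.

(** * Transferring component counts between graphs of different orders *)

Lemma mul_binS_left (R : realType) (n k : nat) : (k <= n)%N ->
  'C(n, k.+1)%:R * k.+1%:R = 'C(n, k)%:R * (n%:R - k%:R) :> R.
Proof.
by move=> kn; rewrite -natrB // -!natrM mulnC mul_bin_left mulnC.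
Qed.

(** The quotient of the two sides is log-convex in k: passing from k to k + 1
    multiplies it by (n - k) x / (M - k), which increases with k.  So the
    inequality holds on an interval as soon as it holds at both ends. *)
Lemma bin_pow_quasiconvex (R : realType) (n M a b k : nat) (x B : R) :
  0 < x <= 1 -> 0 <= B -> (a <= k <= b)%N -> (b <= M <= n)%N ->
  'C(n, a)%:R * x ^+ a <= B * 'C(M, a)%:R ->
  'C(n, b)%:R * x ^+ b <= B * 'C(M, b)%:R ->
  'C(n, k)%:R * x ^+ k <= B * 'C(M, k)%:R.
Proof.
case/andP=> x0 x1 B0 /andP[ak kb] /andP[bM Mn] Pa Pb.
pose P i := 'C(n, i)%:R * x ^+ i <= B * 'C(M, i)%:R.
have up i : (i < M)%N -> (n%:R - i%:R) * x <= M%:R - i%:R -> P i -> P i.+1.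
  move=> iM le_i Pi; rewrite /P -(ler_pM2r (ltr0Sn R i)).
  have -> : 'C(n, i.+1)%:R * x ^+ i.+1 * i.+1%:R =
      ('C(n, i)%:R * x ^+ i) * ((n%:R - i%:R) * x).
    rewrite mulrAC mul_binS_left; last by lia.
    by rewrite exprS; ring.
  rewrite -[leRHS]mulrA mul_binS_left; last by lia.
  rewrite [leRHS]mulrA; apply: ler_pM => //.
    by rewrite mulr_ge0 // exprn_ge0 // ltW.
  by apply: mulr_ge0; [rewrite subr_ge0 ler_nat; lia | exact: ltW].
have down i : (i < M)%N -> M%:R - i%:R <= (n%:R - i%:R) * x -> P i.+1 -> P i.
  move=> iM le_i Pi1.
  have d0 : 0 < (n%:R - i%:R) * x by rewrite mulr_gt0 // subr_gt0 ltr_nat; lia.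
  rewrite /P -(ler_pM2r d0).
  have -> : 'C(n, i)%:R * x ^+ i * ((n%:R - i%:R) * x) =
      'C(n, i.+1)%:R * x ^+ i.+1 * i.+1%:R.
    rewrite [RHS]mulrAC mul_binS_left; last by lia.
    by rewrite exprS; ring.
  apply: (le_trans (y := B * 'C(M, i.+1)%:R * i.+1%:R)).
    by rewrite ler_wpM2r.
  rewrite -[leLHS]mulrA mul_binS_left; last by lia.
  by rewrite [leLHS]mulrA ler_wpM2l // mulr_ge0.
have [kM | Mk] := ltnP k M; last first.
  by have -> : k = b by lia.
have [le_k | /ltW ge_k] := lerP ((n%:R - k%:R) * x) (M%:R - k%:R).
  have le_i i : (i <= k)%N -> (n%:R - i%:R) * x <= M%:R - i%:R.
    move=> ik; have ikR : i%:R <= k%:R :> R by rewrite ler_nat.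
    have : (k%:R - i%:R) * x <= k%:R - i%:R :> R.
      by rewrite ler_piMr // subr_ge0.
    lra.
  suff Pad d : (a + d <= k)%N -> P (a + d)%N.
    by have := Pad (k - a)%N; rewrite subnKC //; apply.
  elim: d => [|d IH] adk; first by rewrite addn0.
  by rewrite addnS; apply: up; [lia | apply: le_i; lia | apply: IH; lia].
have ge_i i : (k <= i < M)%N -> M%:R - i%:R <= (n%:R - i%:R) * x.
  case/andP=> ki iM.
  have kiR : k%:R <= i%:R :> R by rewrite ler_nat.
  have iMR : i%:R < M%:R :> R by rewrite ltr_nat.
  have MnR : M%:R <= n%:R :> R by rewrite ler_nat.
  have kM' : 0 < M%:R - k%:R :> R by lra.
  rewrite -(ler_pM2r kM') -mulrA.
  apply: (le_trans (y := (M%:R - i%:R) * ((n%:R - k%:R) * x))).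
    by rewrite ler_wpM2l //; lra.
  rewrite [leRHS]mulrCA [leRHS]mulrC [leLHS]mulrA ler_wpM2r ?(ltW x0) //.
  have : 0 <= (n%:R - M%:R) * (i%:R - k%:R) :> R by rewrite mulr_ge0 // subr_ge0.
  lra.
suff Pbd d : (k + d <= b)%N -> P (b - d)%N.
  by have := Pbd (b - k)%N; rewrite subKn // subnKC //; apply.
elim: d => [|d IH] kdb; first by rewrite subn0.
apply: down; [lia | apply: ge_i; lia |].
have -> : (b - d.+1).+1 = (b - d)%N by lia.
by apply: IH; lia.
Qed.

(** Comparing the components of size k in the graphs on n and on M vertices:
    the isolation factor q^(k(n-k)) is q^(k(n-M)) times that of the smaller
    graph, whose component sizes add up to M. *)
Lemma sum_mean_comps_window (R : realType) (n M a b : nat) (p B : R) :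
  0 <= p < 1 -> 0 <= B -> (a <= b)%N -> (b <= M <= n)%N ->
  'C(n, a)%:R * (1 - p) ^+ (a * (n - M)) <= B * 'C(M, a)%:R ->
  'C(n, b)%:R * (1 - p) ^+ (b * (n - M)) <= B * 'C(M, b)%:R ->
  \sum_(a <= k < b.+1) k%:R * mean_comps n p k <= B * M%:R.
Proof.
move=> p01 B0 ab /andP[bM Mn] Ha Hb; set x := (1 - p) ^+ (n - M).
have p01' : 0 <= p <= 1 by case/andP: p01 => -> /ltW.
have q0 : 0 < 1 - p by case/andP: p01; lra.
have q1 : 1 - p <= 1 by case/andP: p01; lra.
have x01 : 0 < x <= 1 by rewrite exprn_gt0 // exprn_ile1 // ltW.
have xE k : (1 - p) ^+ (k * (n - M)) = x ^+ k by rewrite mulnC exprM.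
rewrite -(sum_mean_comps M p) -(big_mkord predT (fun k => k%:R * mean_comps M p k)).
rewrite [X in _ <= B * X](big_cat_nat (n := a)) //=; last by nat_lia.
rewrite [X in _ <= B * (_ + X)](big_cat_nat (n := b.+1)) //=; [|nat_lia..].
have ge0 (i j : nat) : 0 <= \sum_(i <= k < j) k%:R * mean_comps M p k.
  by apply: sumr_ge0 => k _; rewrite mulr_ge0 // mean_comps_ge0.
apply: (le_trans (y := B * \sum_(a <= k < b.+1) k%:R * mean_comps M p k)); last first.
  by apply: ler_wpM2l => //; have := ge0 0%N a; have := ge0 b.+1 M.+1; lra.
rewrite big_distrr /= !big_nat; apply: ler_sum => k /andP[ak kb].
rewrite [leRHS]mulrCA ler_wpM2l // /mean_comps.
have -> : (k * (n - k) = k * (n - M) + k * (M - k))%N.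
  by rewrite -mulnDr; congr (_ * _)%N; nat_lia.
rewrite exprD xE.
have akb : (a <= k <= b)%N by nat_lia.
have bMn : (b <= M <= n)%N by nat_lia.
rewrite !xE in Ha Hb; have H := bin_pow_quasiconvex x01 B0 akb bMn Ha Hb.
have c0 : 0 <= pr_connected k p * (1 - p) ^+ (k * (M - k)).
  by case/andP: (pr_connected_01 k p01') => c0 _; rewrite mulr_ge0 // exprn_ge0 // ltW.
have := ler_wpM2r c0 H; congr (_ <= _); ring.
Qed.

(** * The probability of being disconnected *)

Lemma sum_proper_mean_comps (R : realType) (n : nat) (p : R) :
  \sum_(0 <= k < n) k%:R * mean_comps n p k = n%:R * (1 - pr_connected n p).
Proof.
have := sum_mean_comps n p.
rewrite -(big_mkord predT (fun k => k%:R * mean_comps n p k)) big_nat_recr //=.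
rewrite {2}/mean_comps binn subnn muln0 expr0 mulr1 mul1r => sumE.
by rewrite mulrBr mulr1 -[X in X - _]sumE addrK.
Qed.

Lemma mean_comps_le (R : realType) (n k : nat) (p : R) :
  0 <= p <= 1 -> mean_comps n p k <= 'C(n, k)%:R * (1 - p) ^+ (k * (n - k)).
Proof.
move=> p01; have /andP[_ c1] := pr_connected_01 k p01.
apply: ler_wpM2l => //; apply: ler_piMl => //.
by case/andP: p01 => _ p1; rewrite exprn_ge0 // subr_ge0.
Qed.

Lemma disconnected_le (R : realType) (n : nat) (p : R) :
  0 <= p <= 1 ->
  n%:R * (1 - pr_connected n p) <=
  \sum_(0 <= k < n) k%:R * ('C(n, k)%:R * (1 - p) ^+ (k * (n - k))).
Proof.
move=> p01; rewrite -sum_proper_mean_comps; apply: ler_sum => k _.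
by rewrite ler_wpM2l // mean_comps_le.
Qed.

Lemma le_of_expr_bound (R : realType) (n : nat) (q c : R) :
  0 <= q -> 0 <= c -> 2 * n.+1%:R * q ^+ n <= 1 -> 1 < 2 * n.+1%:R * c ^+ n ->
  q <= c.
Proof.
move=> q0 c0 hq hc; rewrite leNgt; apply/negP => cq.
have cqn : c ^+ n <= q ^+ n by rewrite lerXn2r // ltW.
have n0 : 0 <= 2 * n.+1%:R :> R by rewrite mulr_ge0.
by have := ler_wpM2l n0 cqn; lra.
Qed.

(** For few vertices the union bound over all vertex sets is good enough. The
    hypothesis 2 n q^(n-1) <= 1 bounds q away from 1, and then the sizes
    between 2 and n - 2 contribute little. *)
Lemma disconnected_small (R : realType) (n : nat) (p : R) :
  0 <= p < 1 -> (0 < n < 10)%N -> 2 * n%:R * (1 - p) ^+ n.-1 <= 1 ->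
  n%:R * (1 - pr_connected n p) <= n%:R * (2 * n%:R * (1 - p) ^+ n.-1).
Proof.
move=> p01 n10 hq; have p01' : 0 <= p <= 1 by case/andP: p01 => -> /ltW.
apply: le_trans (disconnected_le n p01') _.
have q0 : 0 <= 1 - p by case/andP: p01; lra.
have q1 : 1 - p <= 1 by case/andP: p01; lra.
set q := 1 - p in hq q0 q1 *.
clearbody q.
have qX i : 0 <= q ^+ i by rewrite exprn_ge0.
have qS i : q ^+ i.+1 <= q ^+ i by rewrite exprS ler_piMl.
have qD c i j : q <= c -> q ^+ (i + j) <= q ^+ i * c ^+ j.
  by move=> qc; rewrite exprD ler_wpM2l // lerXn2r // nnegrE (le_trans q0).
have bound c : 0 <= c -> 1 < 2 * n%:R * c ^+ n.-1 -> q <= c.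
  case: n n10 hq => // n _ hq c0; exact: le_of_expr_bound.
case: n n10 hq bound => [|[|[|[|[|[|[|[|[|[|n]]]]]]]]]] //= _ hq bound;
  rewrite !big_nat_recr // big_geq //= !add0r.
all: repeat match goal with |- context [binomial ?a ?b] =>
  let v := eval vm_compute in (binomial a b) in change (binomial a b) with v end.
all: repeat match goal with |- context [muln ?a (subn ?b ?c)] =>
  let v := eval vm_compute in (muln a (subn b c)) in
  change (muln a (subn b c)) with v end.
- lra.
- by have := qX 1%N; lra.
- by have := qX 2%N; lra.
- by have := qX 3%N; have := qS 3%N; lra.
(* From n = 5 on, each numerical bound c on q is any constant such that both
   2 n c^(n-1) > 1 and the resulting polynomial inequality in q = c holds. *)
- have qc : q <= 3 / 5 by apply: bound; lra.
  by have := qX 4%N; have := qD _ 4%N 2%N qc; lra.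
- have qc : q <= 61 / 100 by apply: bound; lra.
  by have := qX 5%N; have := qD _ 5%N 3%N qc; have := qD _ 5%N 4%N qc; lra.
- have qc : q <= 65 / 100 by apply: bound; lra.
  by have := qX 6%N; have := qD _ 6%N 4%N qc; have := qD _ 6%N 6%N qc; lra.
- have qc : q <= 68 / 100 by apply: bound; lra.
  have := qX 7%N; have := qD _ 7%N 5%N qc; have := qD _ 7%N 8%N qc.
  by have := qD _ 7%N 9%N qc; lra.
- have qc : q <= 7 / 10 by apply: bound; lra.
  have := qX 8%N; have := qD _ 8%N 6%N qc; have := qD _ 8%N 10%N qc.
  by have := qD _ 8%N 12%N qc; lra.
Qed.

Lemma bin_le_expn2 (n k : nat) : ('C(n.+1, k) <= 2 ^ n)%N.
Proof.
elim: n k => [|n IH] [|k] //; first by case: k => [|[|k]].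
  by rewrite bin0 expn_gt0.
by rewrite binS expnS mul2n -addnn leq_add.
Qed.

Lemma bin2R (R : realType) (n : nat) :
  'C(n, 2)%:R = n%:R * (n%:R - 1) / 2 :> R.
Proof.
case: n => [|n]; first by rewrite bin0n !mul0r.
have := @mul_binS_left R n.+1 1 isT; rewrite bin1 => <-.
by rewrite mulfK // pnatr_eq0.
Qed.

Lemma bin_pred (n : nat) : (0 < n)%N -> 'C(n, n.-1) = n.
Proof. by case: n => // n _; rewrite binSn. Qed.

(** For q <= 5/7 this makes n q^(n-3) small; for larger q that follows from
    n q^(n-1) <= 1/2, since 2 q^2 >= 1 there. *)
Lemma mul_geometric_le1 (R : realType) (n : nat) :
  (10 <= n)%N -> n%:R * (5 / 7) ^+ (n - 3) <= 1 :> R.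
Proof.
move=> n10; have -> : n = (10 + (n - 10))%N by lia.
elim: (n - 10)%N => [|d IH].
  have -> : (10 + 0 - 3 = 7)%N by [].
  by rewrite addn0; lra.
have -> : (10 + d.+1 - 3 = (10 + d - 3).+1)%N by lia.
rewrite exprS mulrCA; set t := (5 / 7 : R) ^+ _ in IH *.
have t0 : 0 <= t by rewrite exprn_ge0 //; lra.
have -> : (10 + d.+1)%:R = (10 + d)%:R + 1 :> R by rewrite addnS natr1.
have n10R : 10 <= (10 + d)%:R :> R by rewrite ler_nat; lia.
have : t * 10 <= t * (10 + d)%:R by rewrite ler_wpM2l.
lra.
Qed.

(** The left-hand side is the mean total size of the components other than the
    whole graph. The union bound would leave a sum over all sizes between 2 and
    n - 2; instead [sum_mean_comps_window] bounds all of it at once from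
    the values at a few sizes, comparing sizes up to m, about n / 2, with the
    graph on m vertices, and larger sizes with the graph on n - 2 vertices. *)
Lemma disconnected_large (R : realType) (n : nat) (p : R) :
  0 <= p < 1 -> (10 <= n)%N -> 2 * n%:R * (1 - p) ^+ n.-1 <= 1 ->
  n%:R * (1 - pr_connected n p) <= n%:R * (2 * n%:R * (1 - p) ^+ n.-1).
Proof.
move=> p01 n10 hq; have p01' : 0 <= p <= 1 by case/andP: p01 => -> /ltW.
set u := (1 - p) ^+ n.-1 in hq *.
have q0 : 0 < 1 - p by case/andP: p01; lra.
have q1 : 1 - p <= 1 by case/andP: p01; lra.
have u0 : 0 < u by rewrite exprn_gt0.
have nnu0 : 0 <= n%:R ^+ 2 * u by rewrite mulr_ge0 ?(ltW u0) // exprn_ge0.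
have nR : 10 <= n%:R :> R by rewrite ler_nat.
have qle i : (n.-1 <= i)%N -> (1 - p) ^+ i <= u.
  by move=> ni; rewrite /u ler_wiXn2l // ltW.
have [m [j [nE jm]]] : exists m j, n = (m + j + 1)%N /\ (m <= j <= m.+1)%N.
  exists (n.-1)./2, (n - (n.-1)./2.+1)%N.
  by have := odd_double_half n.-1; nat_lia.
have m4 : (4 <= m)%N by nat_lia.
have nuR : n%:R = m%:R + j%:R + 1 :> R by rewrite {1}nE !natrD.
have m4R : 4 <= m%:R :> R by rewrite ler_nat.
have mjR : m%:R <= j%:R :> R by rewrite ler_nat; nat_lia.
(* The sizes 1 and n - 1 together use up half of the bound. *)
have end1 : 1%:R * mean_comps n p 1 <= n%:R * u.
  rewrite mul1r; apply: le_trans (mean_comps_le _ _ p01') _.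
  by rewrite bin1 mul1n subn1.
have endn1 : n.-1%:R * mean_comps n p n.-1 <= n%:R * (n%:R - 1) * u.
  apply: (le_trans (y :=
      n.-1%:R * ('C(n, n.-1)%:R * (1 - p) ^+ (n.-1 * (n - n.-1))))).
    by rewrite ler_wpM2l // mean_comps_le.
  rewrite bin_pred; last by nat_lia.
  have -> : (n.-1 * (n - n.-1) = n.-1)%N.
    by rewrite (_ : n - n.-1 = 1)%N ?muln1 //; nat_lia.
  have -> : n.-1%:R = n%:R - 1 :> R by rewrite -subn1 natrB //; nat_lia.
  by rewrite -/u mulrA (mulrC (_ - 1)).
(* A quarter for the sizes 2 to m: the factors at the two ends are
   q^(2(n-m)) <= u and 'C(n, m) q^(m(n-m)) <= 4 n u / m. *)
have small : \sum_(2 <= k < m.+1) k%:R * mean_comps n p k <= n%:R ^+ 2 * u / 2.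
  have -> : n%:R ^+ 2 * u / 2 = (n%:R ^+ 2 * u / (2 * m%:R)) * m%:R :> R.
    by field; lra.
  apply: (@sum_mean_comps_window R n m 2 m p _ p01); [|nat_lia|nat_lia| |].
  - by rewrite divr_ge0 // mulr_ge0.
  - apply: (le_trans (y := 'C(n, 2)%:R * u)).
      by rewrite ler_wpM2l // qle //; nat_lia.
    rewrite !bin2R.
    have -> : n%:R ^+ 2 * u / (2 * m%:R) * (m%:R * (m%:R - 1) / 2) =
        n%:R * u * (n%:R * (m%:R - 1) / 4) :> R by field; lra.
    have -> : n%:R * (n%:R - 1) / 2 * u = n%:R * u * ((n%:R - 1) / 2) by ring.
    apply: ler_wpM2l; first by rewrite mulr_ge0 // ltW.
    have : n%:R * 3 <= n%:R * (m%:R - 1) :> R by rewrite ler_wpM2l //; lra.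
    lra.
  rewrite binn mulr1.
  have -> : (m * (n - m) = n.-1 + j * m.-1)%N.
    have -> : (n - m = j.+1)%N by nat_lia.
    have -> : n.-1 = (m + j)%N by nat_lia.
    have m0 : (0 < m)%N by nat_lia.
    rewrite mulnS -addnA -[X in (_ = _ + X)%N]mulnS prednK //.
    by rewrite [(m * j)%N]mulnC.
  rewrite exprD -/u exprM ler_pdivlMr; last by lra.
  (* w := 4 q^j satisfies w^2 <= 16 u <= 8 / n, and 'C(n - 1, m - 1) is at most
     4 * 4^(m - 1) *)
  have w1 : 4 * (1 - p) ^+ j <= 1.
    have w0 : 0 <= 4 * (1 - p) ^+ j by rewrite mulr_ge0 // exprn_ge0 // ltW.
    rewrite -(ler_pXn2r (n := 2)) ?nnegrE // expr1n exprMn -exprM.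
    have qj : (1 - p) ^+ (j * 2) <= u by apply: qle; nat_lia.
    have : 20 * u <= 2 * n%:R * u by rewrite ler_pM2r //; lra.
    lra.
  have c4 : 'C(n.-1, m.-1)%:R * ((1 - p) ^+ j) ^+ m.-1 <= 4 :> R.
    apply: (le_trans (y := 4 * (4 * (1 - p) ^+ j) ^+ m.-1)); last first.
      by rewrite ler_piMr // exprn_ile1 // mulr_ge0 // exprn_ge0 // ltW.
    rewrite exprMn mulrA ler_wpM2r ?exprn_ge0 ?(ltW q0) //.
    rewrite -exprS -natrX ler_nat.
    have -> : (4 ^ m.-1.+1 = 2 ^ (2 * m.-1.+1))%N by rewrite expnM.
    have -> : n.-1 = n.-2.+1 by nat_lia.
    by apply: leq_trans (bin_le_expn2 _ _) _; rewrite leq_exp2l //; nat_lia.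
  have diag : m%:R * 'C(n, m)%:R = n%:R * 'C(n.-1, m.-1)%:R :> R.
    rewrite -!natrM; congr (_%:R); have := mul_bin_diag n m.-1.
    by rewrite (prednK (_ : 0 < m)%N) //; nat_lia.
  set y := (_ ^+ _) ^+ _ in c4 *.
  have -> : 'C(n, m)%:R * (u * y) * (2 * m%:R) =
      (m%:R * 'C(n, m)%:R) * (2 * u * y) by ring.
  rewrite diag.
  have -> : n%:R * 'C(n.-1, m.-1)%:R * (2 * u * y) =
      (n%:R * u) * (2 * ('C(n.-1, m.-1)%:R * y)) by ring.
  have -> : n%:R ^+ 2 * u = (n%:R * u) * n%:R by ring.
  apply: ler_wpM2l; first by rewrite mulr_ge0 // ltW.
  lra.
(* The last quarter: removing only two vertices suffices here, because each of
   them accounts for k > m absent edges and 2 (m + 1) >= n - 1. *)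
have large : \sum_(m.+1 <= k < n.-1) k%:R * mean_comps n p k <=
    n%:R ^+ 2 * u / 2.
  have n2R : (n - 2)%:R = n%:R - 2 :> R by rewrite natrB //; nat_lia.
  have -> : n%:R ^+ 2 * u / 2 =
      (n%:R ^+ 2 * u / (2 * (n%:R - 2))) * (n - 2)%:R :> R.
    by rewrite n2R; field; lra.
  rewrite (_ : n.-1 = (n - 2).+1); last by nat_lia.
  have d0 : 0 < 2 * (n%:R - 2) :> R by lra.
  have n2 : (n - (n - 2) = 2)%N by nat_lia.
  apply: (@sum_mean_comps_window R n (n - 2) m.+1 (n - 2) p _ p01);
    rewrite ?n2; [|nat_lia|nat_lia| |].
  - by rewrite divr_ge0 // ltW.
  - apply: (le_trans (y := 'C(n, m.+1)%:R * u)).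
      by rewrite ler_wpM2l // qle //; nat_lia.
    have down : 'C(n, m.+1)%:R * (j%:R * (j%:R - 1)) =
        n%:R * (n%:R - 1) * 'C(n - 2, m.+1)%:R :> R.
      have j1R : j%:R - 1 = (j - 1)%:R :> R by rewrite natrB //; nat_lia.
      have n1R : n%:R - 1 = (n - 1)%:R :> R by rewrite natrB //; nat_lia.
      rewrite j1R n1R -!natrM; congr (_%:R).
      have := mul_bin_down n.-1 m.+1; have := mul_bin_down n m.+1.
      have -> : (n - m.+1 = j)%N by nat_lia.
      have -> : (n.-1 - m.+1 = j - 1)%N by nat_lia.
      rewrite !subn1 subn2 => down1 down2.
      rewrite mulnA [(_ * j)%N]mulnC -down1 -mulnA.
      by rewrite [('C(_, _) * _)%N]mulnC -down2 mulnA.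
    have c0 : 0 <= 'C(n - 2, m.+1)%:R :> R by [].
    have jj : 2 * (n%:R - 1) * (n%:R - 2) <= n%:R * (j%:R * (j%:R - 1)) :> R.
      case/andP: jm => mj; rewrite leq_eqVlt => /orP[/eqP jE | jm'].
        have mE : m%:R = j%:R - 1 :> R by rewrite jE -natr1 addrK.
        have : 5 <= j%:R :> R by rewrite ler_nat; nat_lia.
        rewrite nuR mE; nra.
      have jE : j = m by nat_lia.
      have m5R : 5 <= m%:R :> R by rewrite ler_nat; nat_lia.
      rewrite nuR jE; nra.
    have n10' : 0 < n%:R - 1 :> R by lra.
    have XY : 'C(n, m.+1)%:R * (2 * (n%:R - 2)) <=
        n%:R ^+ 2 * 'C(n - 2, m.+1)%:R :> R.
      rewrite -(ler_pM2r n10').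
      have -> : n%:R ^+ 2 * 'C(n - 2, m.+1)%:R * (n%:R - 1) =
          'C(n, m.+1)%:R * (n%:R * (j%:R * (j%:R - 1))) :> R.
        by rewrite [RHS]mulrCA down; ring.
      by rewrite -mulrA ler_wpM2l //; lra.
    rewrite mulrAC ler_pdivlMr // mulrAC [leRHS]mulrAC.
    by rewrite ler_wpM2r // ltW.
  have -> : 'C(n, n - 2) = 'C(n, 2) by rewrite bin_sub //; nat_lia.
  rewrite binn mulr1 bin2R ler_pdivlMr //.
  have -> : ((n - 2) * 2 = n.-1 + (n - 3))%N by nat_lia.
  rewrite exprD -/u.
  have e1 : n%:R * (1 - p) ^+ (n - 3) <= 1.
    have [q57 | q57] := leP (1 - p) (5 / 7).
      apply: le_trans (mul_geometric_le1 R n10).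
      by rewrite ler_wpM2l // lerXn2r // nnegrE; lra.
    have uE : u = (1 - p) ^+ (n - 3) * (1 - p) ^+ 2.
      by rewrite -exprD; congr (_ ^+ _); nat_lia.
    have qq : 1 <= 2 * (1 - p) ^+ 2 by nra.
    have t0 : 0 <= n%:R * (1 - p) ^+ (n - 3).
      by rewrite mulr_ge0 // exprn_ge0 // ltW.
    have := ler_wpM2l t0 qq; rewrite mulr1 => /le_trans; apply.
    by move: hq; rewrite uE; lra.
  have -> : n%:R * (n%:R - 1) / 2 * (u * (1 - p) ^+ (n - 3)) *
      (2 * (n%:R - 2)) =
      u * ((n%:R - 1) * (n%:R - 2) * (n%:R * (1 - p) ^+ (n - 3))) by field.
  rewrite [leRHS]mulrC ler_wpM2l ?(ltW u0) //.
  apply: (le_trans (y := (n%:R - 1) * (n%:R - 2))); last by nra.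
  by rewrite ler_piMr //; nra.
rewrite -sum_proper_mean_comps big_ltn; last by nat_lia.
rewrite mul0r add0r big_ltn; last by nat_lia.
rewrite (big_cat_nat (n := m.+1)) /=; [|nat_lia|nat_lia].
rewrite (big_cat_nat (m := m.+1) (n := n.-1)) /=; [|nat_lia|nat_lia].
rewrite -[X in \sum_(n.-1 <= _ < X) _](prednK (_ : 0 < n)%N); last by nat_lia.
rewrite big_nat1.
have : n%:R * (2 * n%:R * u) =
    n%:R * u + n%:R * (n%:R - 1) * u + n%:R ^+ 2 * u / 2 + n%:R ^+ 2 * u / 2.
  by field.
lra.
Qed.

Lemma pr_connected_ge (R : realType) (n : nat) (p : R) :
  0 <= p < 1 -> (0 < n)%N ->
  1 - 2 * n%:R * (1 - p) ^+ n.-1 <= pr_connected n p.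
Proof.
move=> p01 n0; have p01' : 0 <= p <= 1 by case/andP: p01 => -> /ltW.
have /andP[c0 _] := pr_connected_01 n p01'.
have [hq | hq] := leP (2 * n%:R * (1 - p) ^+ n.-1) 1; last by lra.
have n0R : 0 < n%:R :> R by rewrite ltr0n.
suff : n%:R * (1 - pr_connected n p) <= n%:R * (2 * n%:R * (1 - p) ^+ n.-1).
  by rewrite ler_pM2l //; lra.
have [n10 | n10] := ltnP n 10; last exact: disconnected_large.
by apply: disconnected_small; rewrite ?n0.
Qed.

(** * Connectedness and isolated vertices *)

Lemma binS2_sub (n : nat) : ('C(n + 1, 2) - 'C(n, 2) = n)%N.
Proof. by rewrite addn1 binS bin1 addKn. Qed.

(** Exactly one isolated vertex in the graph with one more vertex. *)
Lemma expected_no_isolated_le (R : realType) (n : nat) (p : R) :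
  0 <= p < 1 ->
  n%:R * (1 - p) ^+ n * (1 - pr_isolated n p) <= pr_isolated n.+1 p.
Proof.
move=> p01; have p01' : 0 <= p <= 1 by case/andP: p01 => -> /ltW.
have := @pr_no_isolated_le R n 1 p p01' isT.
rewrite binS2_sub addn1 bin1; apply: le_trans.
have /andP[_ i1] := pr_isolated_01 n p01'.
rewrite ler_wpM2r ?subr_ge0 // ler_wpM2r ?ler_nat //.
by rewrite exprn_ge0 // subr_ge0; case/andP: p01'.
Qed.

Lemma expected_connected_le (R : realType) (n : nat) (p : R) :
  0 <= p < 1 -> (0 < n)%N ->
  n%:R * (1 - p) ^+ n * pr_connected n p <= pr_isolated n.+1 p.
Proof.
move=> p01 n0; have p01' : 0 <= p <= 1 by case/andP: p01 => -> /ltW.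
have q0 : 0 <= 1 - p by rewrite subr_ge0; case/andP: p01'.
have w0 : 0 <= n%:R * (1 - p) ^+ n by rewrite mulr_ge0 // exprn_ge0.
(* A single vertex is connected and isolated at once, so n = 1 is apart. *)
have [n1 | n1] := ltnP 1 n.
  apply: le_trans (expected_no_isolated_le n p01).
  by rewrite ler_wpM2l // pr_connected_le_no_isolated.
have -> : n = 1%N by lia.
have /andP[_ c1] := pr_connected_01 1 p01'.
apply: le_trans (@pr_isolated_ge R 2 p p01' isT); rewrite mul1r.
by rewrite ler_piMr // exprn_ge0.
Qed.

(** * The mean number of extra components *)

(** Components with at least a quarter but at most half of the vertices have
    an isolation factor of order q^(n^2/8), which beats the at most 2^n vertex
    sets. *)
Lemma mid_size_le (R : realType) (n k : nat) (q t : R) :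
  0 < q <= 1 -> 0 < t <= 1 / 2 -> q ^+ n <= t ^+ 24 -> (24 <= n)%N ->
  (n <= 4 * k)%N -> (k.*2 <= n)%N ->
  'C(n, k)%:R * q ^+ (k * (n - k)) <= q ^+ n * t.
Proof.
case/andP=> q0 q1 /andP[t0 t2] hq n24 kn4 kn2.
have t1 : t <= 1 by lra.
have qk : q ^+ (k * (n - k)) <= q ^+ n * t ^+ (3 * (n - 8)).
  have q0' i : 0 <= q ^+ i by rewrite exprn_ge0 // ltW.
  have t0' i : 0 <= t ^+ i by rewrite exprn_ge0 // ltW.
  rewrite -(ler_pXn2r (n := 8)) ?nnegrE ?mulr_ge0 // exprMn -!exprM.
  apply: (le_trans (y := q ^+ (n * 8 + n * (n - 8)))).
    by rewrite ler_wiXn2l ?(ltW q0) //; nia.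
  rewrite exprD ler_wpM2l // exprM.
  have -> : (3 * (n - 8) * 8 = 24 * (n - 8))%N by nat_lia.
  by rewrite exprM lerXn2r // nnegrE.
have qn0 : 0 <= q ^+ n by rewrite exprn_ge0 // ltW.
apply: (le_trans (y := 2 ^+ n * (q ^+ n * t ^+ (3 * (n - 8))))).
  apply: ler_pM => //; first by rewrite exprn_ge0 // ltW.
  case: n {hq n24 kn4 kn2 qk qn0} => [|n]; first by rewrite bin0n; case: k.
  rewrite -natrX ler_nat (leq_trans (bin_le_expn2 _ _)) //.
  by rewrite leq_exp2l.
rewrite mulrCA ler_wpM2l //.
apply: (le_trans (y := 2 ^+ n * t ^+ n.+1)).
  by rewrite ler_wpM2l ?exprn_ge0 // ler_wiXn2l ?(ltW t0) //; nat_lia.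
rewrite exprSr mulrA -exprMn ler_piMl ?(ltW t0) // exprn_ile1 //.
  by rewrite mulr_ge0 // ltW.
lra.
Qed.

(** When q^n is small, non-isolated components with at most n / 2 vertices are
    rare: those of sizes 2 to n / 4 are compared with the graph on about n / 4
    vertices, which costs a factor of about q^(3n/2), small against q^n, and
    the others fall under [mid_size_le]. *)
Lemma mean_extra_le_sparse (R : realType) (n : nat) (p t : R) :
  0 <= p < 1 -> 0 < t <= 1 / 2 -> (1 - p) ^+ n <= t ^+ 24 -> (24 <= n)%N ->
  mean_extra_components n p <=
  n%:R * (1 - p) ^+ n * ((1 - p)^-1 + 5 * t).
Proof.
move=> p01 t12 hq n24; have p01' : 0 <= p <= 1 by case/andP: p01 => -> /ltW.
have q0 : 0 < 1 - p by case/andP: p01; lra.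
have q1 : 1 - p <= 1 by case/andP: p01; lra.
have [t0 t2] := andP t12.
set Q := (1 - p) ^+ n in hq *.
have Q0 : 0 < Q by rewrite exprn_gt0.
have q01 : 0 < 1 - p <= 1 by rewrite q0.
pose m := (n %/ 4).+1.
have mn3 : (3 * m <= n)%N by rewrite /m; nat_lia.
have mn8 : (n.-1 <= 8 * m.-1)%N by rewrite /m /=; nat_lia.
have mn4 : (n <= 4 * m)%N by rewrite /m; nat_lia.
have nR : 24 <= n%:R :> R by rewrite ler_nat.
have mR : 0 < m%:R :> R by rewrite ltr0n.
have b0 k : 0 <= mean_comps n p k by exact: mean_comps_ge0.
apply: le_trans (mean_extra_le_small n p01') _.
rewrite -(big_mkord (fun k => (0 < k)%N && (k.*2 <= n)%N) (mean_comps n p)).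
rewrite big_mkcond /=.
rewrite big_ltn //= add0r big_ltn; last by nat_lia.
rewrite (_ : (0 < 1)%N && (1.*2 <= n)%N = true); last by rewrite /=; nat_lia.
rewrite (big_cat_nat (n := m.+1)) /=; [|nat_lia|nat_lia].
have single : mean_comps n p 1 <= n%:R * Q * (1 - p)^-1.
  apply: le_trans (mean_comps_le _ _ p01') _; rewrite bin1 mul1n subn1.
  have -> : Q = (1 - p) ^+ n.-1 * (1 - p) by rewrite -exprSr prednK //; nat_lia.
  by rewrite mulrA mulfK // gt_eqF.
have small : \sum_(2 <= k < m.+1)
    (if (0 < k)%N && (k.*2 <= n)%N then mean_comps n p k else 0) <=
    n%:R * Q * (4 * t).
  apply: (le_trans (y :=
      \sum_(2 <= k < m.+1) (1 / 2) * (k%:R * mean_comps n p k))).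
    rewrite !big_nat; apply: ler_sum => k /andP[k2 km].
    have k2R : 2 <= k%:R :> R by rewrite ler_nat.
    have := ler_wpM2r (b0 k) k2R.
    by case: ifP => _; have := b0 k; lra.
  rewrite -big_distrr /=.
  suff : \sum_(2 <= k < m.+1) k%:R * mean_comps n p k <=
      (8 * n%:R * Q * t / m%:R) * m%:R.
    by rewrite divfK ?gt_eqF //; lra.
  apply: (@sum_mean_comps_window R n m 2 m p _ p01); [| |nat_lia| |].
  - by rewrite divr_ge0 ?(ltW mR) // !mulr_ge0 // ltW.
  - by rewrite /m; nat_lia.
  - have q2 : (1 - p) ^+ (2 * (n - m)) <= Q * t ^+ 8.
      have q0' i : 0 <= (1 - p) ^+ i by rewrite exprn_ge0 // ltW.
      have t0' i : 0 <= t ^+ i by rewrite exprn_ge0 // ltW.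
      have Qt0 : 0 <= Q * t ^+ 8 by rewrite mulr_ge0 // ltW.
      rewrite -(ler_pXn2r (n := 3)) ?nnegrE // exprMn -!exprM.
      apply: (le_trans (y := (1 - p) ^+ (n * 3 + n))).
        by rewrite ler_wiXn2l ?(ltW q0) //; nat_lia.
      by rewrite exprD ler_wpM2l.
    have t81 : t ^+ 8 <= t.
      by rewrite exprS ler_piMr ?(ltW t0) // exprn_ile1 ?(ltW t0) //; lra.
    apply: (le_trans (y := 'C(n, 2)%:R * (Q * t))).
      by rewrite ler_wpM2l // (le_trans q2) // ler_wpM2l // ltW.
    rewrite !bin2R.
    have -> : 8 * n%:R * Q * t / m%:R * (m%:R * (m%:R - 1) / 2) =
      n%:R * Q * t * (4 * (m%:R - 1)) by field; rewrite gt_eqF.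
    have -> : n%:R * (n%:R - 1) / 2 * (Q * t) =
      n%:R * Q * t * ((n%:R - 1) / 2) by ring.
    apply: ler_wpM2l; first by rewrite !mulr_ge0 // ltW.
    have -> : m%:R - 1 = m.-1%:R :> R by rewrite -subn1 natrB.
    have -> : n%:R - 1 = n.-1%:R :> R by rewrite -subn1 natrB //; nat_lia.
    have : n.-1%:R <= 8 * m.-1%:R :> R by rewrite -natrM ler_nat.
    lra.
  - rewrite binn mulr1; apply: le_trans (mid_size_le q01 t12 hq n24 mn4 _) _.
      by nat_lia.
    rewrite -/Q ler_pdivlMr //.
    have mnR : m%:R <= n%:R :> R by rewrite ler_nat; nat_lia.
    have := ler_wpM2l (ltW (mulr_gt0 Q0 t0)) mnR.
    have : 0 <= Q * t * n%:R by rewrite !mulr_ge0 // ltW.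
    lra.
have mid : \sum_(m.+1 <= k < n.+1)
    (if (0 < k)%N && (k.*2 <= n)%N then mean_comps n p k else 0) <=
    n%:R * Q * t.
  apply: (le_trans (y := \sum_(m.+1 <= k < n.+1) Q * t)).
    rewrite !big_nat; apply: ler_sum => k /andP[mk kn].
    case: ifP => [/andP[_ k2n] | _]; last by rewrite mulr_ge0 // ltW.
    apply: le_trans (mean_comps_le _ _ p01') _.
    by apply: mid_size_le => //; nat_lia.
  rewrite sumr_const_nat -[leLHS]mulr_natl -[leRHS]mulrA ler_wpM2r //.
    by rewrite mulr_ge0 // ltW.
  by rewrite ler_nat; nat_lia.
have -> : n%:R * Q * ((1 - p)^-1 + 5 * t) =
    n%:R * Q * (1 - p)^-1 + (n%:R * Q * (4 * t) + n%:R * Q * t) by ring.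
by rewrite lerD // lerD.
Qed.

(** When q^n stays away from 0, adding two isolated vertices to a graph without
    isolated vertices shows that the latter has probability O(1 / n^2), which
    more than compensates for the number of components, at most n. *)
Lemma no_isolated_mean_extra_dense (R : realType) (n : nat) (p t : R) :
  0 <= p < 1 -> 0 < t <= 1 / 2 -> t ^+ 24 <= (1 - p) ^+ n ->
  (0 < n)%N -> 4 <= n%:R * t ^+ 73 ->
  (1 - pr_isolated n p) * mean_extra_components n p <=
  t * pr_isolated n.+1 p.
Proof.
move=> p01 /andP[t0 t2] hq n0 nt.
have p01' : 0 <= p <= 1 by case/andP: p01 => -> /ltW.
have q0 : 0 < 1 - p by case/andP: p01; lra.
have q1 : 1 - p <= 1 by case/andP: p01; lra.
have t0' i : 0 <= t ^+ i by rewrite exprn_ge0 // ltW.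
have t1 : t <= 1 by lra.
have n0R : 0 < n%:R :> R by rewrite ltr0n.
have qt i : t ^+ (24 * i) <= (1 - p) ^+ (n * i).
  by rewrite !exprM lerXn2r // nnegrE exprn_ge0 // ltW.
set r := 1 - pr_isolated n p.
have r0 : 0 <= r by have /andP[_ ?] := pr_isolated_01 n p01'; rewrite subr_ge0.
have r_le : r * (n%:R * n%:R * t ^+ 72) <= 2.
  have := @pr_no_isolated_le R n 2 p p01' isT.
  have /andP[_ i1] := pr_isolated_01 (n + 2) p01'.
  move=> /le_trans/(_ i1); rewrite -/r.
  have -> : ('C(n + 2, 2) - 'C(n, 2) = 2 * n + 1)%N.
    by rewrite bin2_add (_ : 'C(2, 2) = 1%N) //; nat_lia.
  have qn3 : t ^+ 72 <= (1 - p) ^+ (2 * n + 1).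
    by rewrite (le_trans (qt 3%N)) // ler_wiXn2l ?(ltW q0) //; nat_lia.
  have c2 : n%:R * n%:R / 2 <= 'C(n + 2, 2)%:R :> R.
    by rewrite bin2R natrD; nra.
  move=> h; have : n%:R * n%:R / 2 * t ^+ 72 * r <= 1.
    apply: le_trans h; apply: ler_wpM2r => //.
    by apply: ler_pM => //; rewrite divr_ge0 // mulr_ge0.
  lra.
have i_ge : 1 / 2 <= pr_isolated n.+1 p.
  have := expected_no_isolated_le n.+1 p01.
  have /andP[_ i1] := pr_isolated_01 n.+2 p01'.
  move=> /le_trans/(_ i1).
  have qn2 : t ^+ 48 <= (1 - p) ^+ n.+1.
    by rewrite (le_trans (qt 2%N)) // ler_wiXn2l ?(ltW q0) //; nat_lia.
  have t4873 : t ^+ 73 <= t ^+ 48 by rewrite ler_wiXn2l // ltW.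
  have n1 : 4 <= n.+1%:R * (1 - p) ^+ n.+1.
    apply: le_trans nt _; apply: ler_pM => //; last exact: le_trans qn2.
    by rewrite ler_nat.
  have /andP[_ i1'] := pr_isolated_01 n.+1 p01'.
  have : 4 * (1 - pr_isolated n.+1 p) <=
      n.+1%:R * (1 - p) ^+ n.+1 * (1 - pr_isolated n.+1 p).
    by rewrite ler_wpM2r // subr_ge0.
  lra.
apply: (le_trans (y := r * n%:R)); first by rewrite ler_wpM2l // mean_extra_le.
apply: (le_trans (y := t * (1 / 2))); last by rewrite ler_wpM2l // ltW.
have nt72 : 0 < n%:R * t ^+ 72 by rewrite mulr_gt0 // exprn_gt0.
rewrite -(ler_pM2r nt72).
have -> : r * n%:R * (n%:R * t ^+ 72) = r * (n%:R * n%:R * t ^+ 72) by ring.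
have -> : t * (1 / 2) * (n%:R * t ^+ 72) = n%:R * t ^+ 73 / 2 by rewrite exprS; ring.
lra.
Qed.

(** The two regimes are separated by the threshold t^24 for q^n, so that one N
    serves all p. *)
Lemma no_isolated_mean_extra (R : realType) (t : R) :
  0 < t <= 1 / 2 ->
  exists N : nat, forall (n : nat) (p : R), (N <= n)%N -> 0 <= p < 1 ->
    (1 - pr_isolated n p) * mean_extra_components n p <=
    ((1 - p)^-1 + 5 * t) * pr_isolated n.+1 p.
Proof.
move=> t12; have [t0 t2] := andP t12.
have t73 : 0 < t ^+ 73 by rewrite exprn_gt0.
pose M := Num.bound (4 / t ^+ 73).
exists (24 + M)%N => n p Nn p01.
have p01' : 0 <= p <= 1 by case/andP: p01 => -> /ltW.
have q0 : 0 < 1 - p by case/andP: p01; lra.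
have /andP[i0 _] := pr_isolated_01 n.+1 p01'.
have /andP[_ i1] := pr_isolated_01 n p01'.
have qV : 0 < (1 - p)^-1 by rewrite invr_gt0.
have [hq | /ltW hq] := leP ((1 - p) ^+ n) (t ^+ 24).
  apply: le_trans (_ : (1 - pr_isolated n p) *
      (n%:R * (1 - p) ^+ n * ((1 - p)^-1 + 5 * t)) <= _).
    by rewrite ler_wpM2l ?subr_ge0 // mean_extra_le_sparse //; nat_lia.
  set s := _ + 5 * t.
  have -> : (1 - pr_isolated n p) * (n%:R * (1 - p) ^+ n * s) =
      s * (n%:R * (1 - p) ^+ n * (1 - pr_isolated n p)) by ring.
  apply: ler_wpM2l; last exact: expected_no_isolated_le.
  by rewrite /s; lra.
apply: (le_trans (no_isolated_mean_extra_dense p01 t12 hq _ _)).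
- by nat_lia.
- rewrite -ler_pdivrMr //; apply: le_trans (ltW (archi_boundP _)) _.
    by rewrite divr_ge0 // ltW.
  by rewrite -/M ler_nat; nat_lia.
- by rewrite ler_wpM2r //; lra.
Qed.

(** * Replacing the mean number of isolated vertices *)

(** Since (1 - p)(1 + p) <= 1, the hypothesis gives (1 + p)^n <= n / C, while
    (1 + p)^n is at least the quadratic term n (n - 1) p^2 / 2 of its binomial
    expansion. *)
Lemma edge_pr_small (R : realType) (n : nat) (p C : R) :
  0 <= p < 1 -> (0 < n)%N -> 0 <= C -> C <= n%:R * (1 - p) ^+ n ->
  p ^+ 2 * (C * (n%:R - 1)) <= 2.
Proof.
case/andP=> p0 p1 n0 C0 hC.
have q0 : 0 <= (1 - p) ^+ n by rewrite exprn_ge0 //; lra.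
have n0R : 0 < n%:R :> R by rewrite ltr0n.
have n1R : 1 <= n%:R :> R by rewrite ler1n.
have binom k : k%:R * (k%:R - 1) / 2 * p ^+ 2 <= (1 + p) ^+ k.
  suff : 1 + k%:R * p + k%:R * (k%:R - 1) / 2 * p ^+ 2 <= (1 + p) ^+ k.
    have : 0 <= k%:R * p by rewrite mulr_ge0.
    lra.
  elim: k => [|k IH]; first by rewrite expr0; lra.
  rewrite [(1 + p) ^+ _]exprS -natr1.
  have p01 : 0 <= 1 + p by lra.
  apply: le_trans (ler_wpM2l p01 IH).
  have [->|k0] := posnP k; first by lra.
  have k1 : 1 <= k%:R :> R by rewrite ler1n.
  have : 0 <= (k%:R * (k%:R - 1)) * (p ^+ 2 * p).
    by apply: mulr_ge0; apply: mulr_ge0; rewrite ?exprn_ge0 //; lra.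
  lra.
have pq : (1 - p) ^+ n * (1 + p) ^+ n <= 1.
  by rewrite -exprMn exprn_ile1 //; nra.
have : n%:R * (p ^+ 2 * (C * (n%:R - 1))) <= n%:R * 2.
  have w0 : 0 <= n%:R * (n%:R - 1) / 2 * p ^+ 2.
    by rewrite mulr_ge0 ?exprn_ge0 // divr_ge0 // mulr_ge0 //; lra.
  have l0 : 0 <= n%:R * (1 - p) ^+ n by rewrite mulr_ge0.
  have h1 := ler_wpM2r w0 hC; have h2 := ler_wpM2l l0 (binom n).
  have h3 := ler_wpM2l (ltW n0R) pq.
  lra.
by rewrite ler_pM2l.
Qed.

Lemma no_isolated_mean_extra_near (R : realType) (C eps : R) :
  0 < C -> 0 < eps ->
  exists N : nat, forall (n : nat) (p : R), (N <= n)%N -> 0 <= p < 1 ->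
    C <= n%:R * (1 - p) ^+ n ->
    (1 - pr_isolated n p) * mean_extra_components n p <=
    (1 + eps) * pr_isolated n.+1 p.
Proof.
move=> C0 eps0; pose t := Num.min (1 / 2) (eps / 10).
have t0 : 0 < t by rewrite lt_min; apply/andP; split; lra.
have t2 : t <= 1 / 2 by rewrite ge_min lexx.
have te : t <= eps / 10 by rewrite ge_min lexx orbT.
have t12 : 0 < t <= 1 / 2 by rewrite t0.
have [N1 HN1] := no_isolated_mean_extra t12.
have t2C : 0 < t ^+ 2 * C by rewrite mulr_gt0 // exprn_gt0.
pose N2 := Num.bound (2 / (t ^+ 2 * C)).
exists (N1 + N2 + 2)%N => n p Nn p01 hC.
have p01' : 0 <= p <= 1 by case/andP: p01 => -> /ltW.
have [p0 p1] := andP p01.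
have pt : p <= t.
  rewrite leNgt; apply/negP => tp.
  have nR : 2 / (t ^+ 2 * C) < n%:R - 1.
    apply: lt_le_trans (archi_boundP _) _; first by rewrite divr_ge0 // ltW.
    rewrite -/N2 lerBrDr natr1 ler_nat; clear -Nn; lia.
  have n0 : (0 < n)%N by clear -Nn; lia.
  have := edge_pr_small p01 n0 (ltW C0) hC.
  move: nR; rewrite ltr_pdivrMr // => nR.
  have tp2 : t ^+ 2 <= p ^+ 2 by rewrite lerXn2r ?nnegrE // ltW.
  have n1 : 0 <= C * (n%:R - 1) by rewrite mulr_ge0 ?(ltW C0) // subr_ge0 ler1n.
  have := ler_wpM2r n1 tp2.
  lra.
have /andP[i0 _] := pr_isolated_01 n.+1 p01'.
apply: le_trans (HN1 n p _ p01) _; first by clear -Nn; lia.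
rewrite ler_wpM2r //.
have q0 : 0 < 1 - p by lra.
have : (1 - p)^-1 <= 1 + 2 * p.
  rewrite -(ler_pM2r q0) mulVf ?gt_eqF //; nra.
lra.
Qed.

(** The lower bound for p_n and the upper bound for pi_n ask for a large e. They
    hold once e is at least E(nu_n - 1), by Markov's inequality, or at least
    n q^n, by the bounds already proved. The other three relations ask for a
    small e and all follow from its single upper bound. *)
Lemma relations_of_threshold (R : realType) (n : nat) (p e : R) :
  0 <= p < 1 -> (1 < n)%N ->
  mean_extra_components n p <= e \/ n%:R * (1 - p) ^+ n <= e ->
  e * (1 - pr_isolated n p) <= pr_isolated n.+1 p ->
  [/\ 1 - 2 * e / (1 - p) <= pr_connected n p <= 1 / e,
      1 - 1 / e <= pr_isolated n p <= e / (1 - p)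
    & e * pr_connected n p <= pr_isolated n.+1 p].
Proof.
move=> p01 n1 he hr; have p01' : 0 <= p <= 1 by case/andP: p01 => -> /ltW.
have n0 : (0 < n)%N by exact: ltnW.
have q0 : 0 < 1 - p by case/andP: p01; lra.
have q1 : 1 - p <= 1 by case/andP: p01; lra.
have pc := pr_connected_le_no_isolated p01' n1.
have /andP[c0 c1] := pr_connected_01 n p01'.
have /andP[i0 i1] := pr_isolated_01 n p01'.
have /andP[_ i1'] := pr_isolated_01 n.+1 p01'.
have disc := mean_extra_ge_disconnected n0 p01'.
have iso0 : 0 < pr_isolated n p.
  by apply: lt_le_trans (pr_isolated_ge p01' n0); rewrite exprn_gt0.
have e0 : 0 < e.
  case: he => [|he]; first by lra.
  by apply: lt_le_trans he; rewrite mulr_gt0 ?exprn_gt0 ?ltr0n.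
have qn : (1 - p) ^+ n = (1 - p) ^+ n.-1 * (1 - p) by rewrite -exprSr prednK.
have eq_e : e <= e / (1 - p) by rewrite ler_pdivlMr // ler_piMr // ltW.
have ec : e * pr_connected n p <= pr_isolated n.+1 p.
  by apply: le_trans hr; rewrite ler_wpM2l // ltW.
have [lo up] : 1 - 2 * e / (1 - p) <= pr_connected n p /\
    pr_isolated n p <= e / (1 - p).
  case: he => he; first by rewrite -mulrA; split; lra.
  have le_e : n%:R * (1 - p) ^+ n.-1 <= e / (1 - p).
    by rewrite ler_pdivlMr // -mulrA -qn.
  have := pr_connected_ge p01 n0; have := pr_isolated_le n p01'.
  by rewrite -mulrA; split; lra.
split=> //; first by rewrite lo ler_pdivlMr // mulrC (le_trans ec).
rewrite up andbT; suff : 1 - pr_isolated n p <= 1 / e by lra.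
by rewrite ler_pdivlMr // mulrC (le_trans hr).
Qed.

From mathcomp Require Import all_classical all_reals all_analysis.

Import Order.TTheory GRing.Theory Num.Theory.
Import numFieldNormedType.Exports.
Local Open Scope classical_set_scope.
Local Open Scope ring_scope.

Theorem theorem5 (R : realType) :
  (forall p : R, 0 <= p < 1 ->
   let q := 1 - p in
   forall n : nat, (1 <= n)%N ->
     [/\ 1 - 2 * n%:R * q ^+ n.-1 <= pr_connected n p <= 1 / (n%:R * q ^+ n),
         1 - 1 / (n%:R * q ^+ n) <= pr_isolated n p <= n%:R * q ^+ n.-1
       & n%:R * q ^+ n * pr_connected n p <= pr_isolated n.+1 p])
  /\
  (forall (p : nat -> R) (C : R),
     (forall n : nat, (1 <= n)%N -> 0 <= p n < 1) ->
     0 < C ->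
     (\forall n \near \oo, C <= n%:R * (1 - p n) ^+ n) ->
   exists delta : nat -> R,
     delta @ \oo --> (0 : R) /\
     \forall n \near \oo,
       let q := 1 - p n in
       let e := mean_extra_components n (p n) * (1 + delta n) in
       [/\ 1 - 2 * e / q <= pr_connected n (p n) <= 1 / e,
           1 - 1 / e <= pr_isolated n (p n) <= e / q
         & e * pr_connected n (p n) <= pr_isolated n.+1 (p n)]).
Proof.
split=> [p p01 q n n0 | p C hp C0 [N0 _ hC]].
  have p01' : 0 <= p <= 1 by case/andP: p01 => -> /ltW.
  have q0 : 0 < q by rewrite subr_gt0; case/andP: p01.
  have nq0 : 0 < n%:R * q ^+ n by rewrite mulr_gt0 ?ltr0n // exprn_gt0.
  have /andP[_ i1] := pr_isolated_01 n.+1 p01'.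
  have conn := expected_connected_le p01 n0.
  have noiso := expected_no_isolated_le n p01.
  split=> //.
    rewrite pr_connected_ge //= ler_pdivlMr // mulrC.
    exact: le_trans conn i1.
  rewrite pr_isolated_le // andbT lerBlDr -lerBlDl ler_pdivlMr // mulrC.
  exact: le_trans noiso i1.
pose mu n := mean_extra_components n (p n).
pose r n := 1 - pr_isolated n (p n).
pose iso n := pr_isolated n.+1 (p n).
have mr_gt0 n : 0 <= p n <= 1 -> iso n < mu n * r n -> 0 < mu n /\ 0 < r n.
  move=> p01 lt_iso; have /andP[iso0 _] := pr_isolated_01 n.+1 p01.
  have r0 : 0 <= r n by rewrite subr_ge0; case/andP: (pr_isolated_01 n p01).
  have mr0 : 0 < mu n * r n by exact: le_lt_trans lt_iso.
  have rn0 : 0 < r n.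
    by rewrite lt_def r0 andbT; apply: contraTneq mr0 => ->; rewrite mulr0 ltxx.
  by rewrite -(pmulr_lgt0 _ rn0).
exists (fun n => if mu n * r n <= iso n then 0 else iso n / (mu n * r n) - 1).
split.
  apply/cvgr0Pnorm_lt => eps eps0.
  have eps2 : 0 < eps / 2 by rewrite divr_gt0.
  have [N1 HN1] := no_isolated_mean_extra_near C0 eps2.
  exists (maxn (maxn N0 N1) 1) => // n /= nN.
  have /andP[/andP[nN0 nN1] n0] : (N0 <= n)%N && (N1 <= n)%N && (1 <= n)%N.
    by rewrite -!geq_max.
  have p01 := hp n n0; have p01' : 0 <= p n <= 1 by case/andP: p01 => -> /ltW.
  have := HN1 n (p n) nN1 p01 (hC n nN0).
  rewrite mulrC -/(mu n) -/(r n) -/(iso n) => le_iso.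
  have iso0 : 0 <= iso n by case/andP: (pr_isolated_01 n.+1 p01').
  case: ifPn => [_ | ]; first by rewrite normr0.
  rewrite -ltNge => lt_iso.
  have mr0 : 0 < mu n * r n by exact: le_lt_trans lt_iso.
  rewrite ler0_norm; last by rewrite subr_le0 ler_pdivrMr // mul1r ltW.
  rewrite opprB; apply: (le_lt_trans (y := eps / 2)).
    rewrite lerBlDr -lerBlDl ler_pdivlMr //; nra.
  lra.
exists (maxn N0 2) => // n /= nN.
have /andP[nN0 n2] : (N0 <= n)%N && (2 <= n)%N by rewrite -geq_max.
have n0 : (0 < n)%N by exact: ltnW.
have p01 := hp n n0; have p01' : 0 <= p n <= 1 by case/andP: p01 => -> /ltW.
(* So e is the smaller of mu and iso / r, and the latter is at least n q^n. *)
have eE : iso n < mu n * r n ->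
    mu n * (1 + (iso n / (mu n * r n) - 1)) = iso n / r n.
  move=> /(mr_gt0 n p01')[m0 r0]; field.
  by rewrite !gt_eqF.
apply: relations_of_threshold => //; rewrite -/(mu n) -/(r n) -/(iso n).
  case: ifPn => [_ | ]; first by left; rewrite addr0 mulr1.
  rewrite -ltNge => lt_iso; have [_ r0] := mr_gt0 n p01' lt_iso.
  right; rewrite eE // ler_pdivlMr //.
  exact: expected_no_isolated_le.
case: ifPn => [le_iso | ]; first by rewrite addr0 mulr1.
rewrite -ltNge => lt_iso; have [_ r0] := mr_gt0 n p01' lt_iso.
by rewrite eE // divfK // gt_eqF.
Qed.
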